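(* Let $\Gamma=\mathrm{PSL}_{2}(\mathbb{Z})$ and $M=\Gamma\backslash\mathbb{H}$. For every $\varepsilon>0$ there exist a constant $c_{\varepsilon}>0$ and an integer $k_{\varepsilon}$ such that for all integers $k\geq k_{\varepsilon}$ $$\sup_{z\in M}S_{k}^{\Gamma}(z)\geq c_{\varepsilon}\,k^{3/2-\varepsilon}.$$
   Context: $\mathbb{H}=\{z=x+iy\in\mathbb{C}: y>0\}$ is the upper half-plane, on which $\mathrm{PSL}_{2}(\mathbb{R})$ acts by fractional linear transformations. $\mu_{\mathrm{hyp}}(z)=\frac{\mathrm{d}x\wedge\mathrm{d}y}{y^{2}}$ is the hyperbolic volume form. For an integer $k\geq 1$, $\mathcal{S}_{2k}^{\Gamma}$ is the finite-dimensional complex vector space of cusp forms of weight $2k$ for $\Gamma$, i.e. holomorphic $f:\mathbb{H}\to\mathbb{C}$ with $f(\gamma z)=(cz+d)^{2k}f(z)$ for all $\gamma=\begin{pmatrix}a&b\\c&d\end{pmatrix}\in\Gamma$ that vanish at the cusp of $M$. It carries the Petersson inner product $\langle f_{1},f_{2}\rangle=\int_{M}f_{1}(z)\overline{f_{2}(z)}\,y^{2k}\,\mu_{\mathrm{hyp}}(z)$. For an orthonormal basis $\{f_{1},\ldots,f_{d}\}$ of $\mathcal{S}_{2k}^{\Gamma}$, put $S_{k}^{\Gamma}(z):=\sum_{j=1}^{d}|f_{j}(z)|^{2}\,\mathrm{Im}(z)^{2k}$ for $z\in\mathbb{H}$. This is independent of the choice of orthonormal basis and $\Gamma$-invariant,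 hence a function on $M$. *)

(* Defs.v *)
From HB Require Import structures.
From mathcomp Require Import all_boot all_order all_algebra.
From mathcomp Require Import all_classical all_reals all_analysis.
From mathcomp Require Import complex.

Set Implicit Arguments.
Unset Strict Implicit.
Unset Printing Implicit Defensive.

Import Order.TTheory GRing.Theory Num.Theory.
Import numFieldNormedType.Exports.

Local Open Scope classical_set_scope.
Local Open Scope ring_scope.
Local Open Scope complex_scope.

Section CuspForms.
Variable R : realType.

Definition upper_half_plane : set R[i] := [set z | 0 < complex.Im z].

Definition denom (g : 'M[int]_2) (z : R[i]) : R[i] :=
  (g 1 0)%:~R * z + (g 1 1)%:~R.

Definition moebius (g : 'M[int]_2) (z : R[i]) : R[i] :=
  ((g 0 0)%:~R * z + (g 0 1)%:~R) / denom g z.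

(* Functions on the upper half-plane are represented by total functions on
   R[i]; their values outside the half-plane are never constrained or used.
   The base field of the derivative is R[i] itself, so derivability at z in
   the direction 1 is complex differentiability at z. *)
Definition holomorphic (f : R[i] -> R[i]) : Prop :=
  forall z, upper_half_plane z -> derivable (f : R[i]^o -> R[i]^o) z 1.

(* PSL_2(Z) is represented by SL_2(Z): since the weight is even, the condition
   is the same for g and - g. *)
Definition modular_invariant (k : nat) (f : R[i] -> R[i]) : Prop :=
  forall g : 'M[int]_2, \det g = 1 -> forall z, upper_half_plane z ->
    f (moebius g z) = denom g z ^+ (2 * k) * f z.

(* f z --> 0 as Im z --> +oo, uniformly in Re z. *)
Definition vanishes_at_cusp (f : R[i] -> R[i]) : Prop :=
  forall e : R, 0 < e -> exists Y : R,
    forall z, upper_half_plane z -> Y < complex.Im z -> `|f z| < e%:C.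

Definition cusp_form (k : nat) (f : R[i] -> R[i]) : Prop :=
  [/\ holomorphic f, modular_invariant k f & vanishes_at_cusp f].

(* The standard fundamental domain of PSL_2(Z), in the coordinates
   (x, y) of z = x + iy; its boundary is a null set, so integrals of invariant
   functions over the modular surface are integrals over this set. *)
Definition fundamental_domain : set (R * R) :=
  [set p | [/\ 0 < p.2, `|p.1| <= 2^-1 & 1 <= p.1 ^+ 2 + p.2 ^+ 2]].

Definition hyp_Rintegral (F : R[i] -> R) : R :=
  \int[(@lebesgue_measure R \x @lebesgue_measure R)%E]_(p in fundamental_domain)
    (F (p.1 +i* p.2) / p.2 ^+ 2).

Definition hyp_integral (F : R[i] -> R[i]) : R[i] :=
  hyp_Rintegral (fun z => complex.Re (F z))
  +i* hyp_Rintegral (fun z => complex.Im (F z)).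

Definition petersson (k : nat) (f1 f2 : R[i] -> R[i]) : R[i] :=
  hyp_integral (fun z => f1 z * (f2 z)^* * (complex.Im z ^+ (2 * k))%:C).

Definition cusp_form_basis (k d : nat) (f : 'I_d -> R[i] -> R[i]) : Prop :=
  [/\ forall j, cusp_form k (f j),
      forall a : 'I_d -> R[i],
        (forall z, upper_half_plane z -> \sum_(j < d) a j * f j z = 0) ->
        forall j, a j = 0
    & forall g, cusp_form k g -> exists a : 'I_d -> R[i],
        forall z, upper_half_plane z -> g z = \sum_(j < d) a j * f j z].

Definition orthonormal_cusp_basis (k d : nat) (f : 'I_d -> R[i] -> R[i]) : Prop :=
  cusp_form_basis k f /\ forall i j, petersson k (f i) (f j) = (i == j)%:R.

Definition S_Gamma (k d : nat) (f : 'I_d -> R[i] -> R[i]) (z : R[i]) : R :=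
  \sum_(j < d) complex.Re `|f j z| ^+ 2 * complex.Im z ^+ (2 * k).

End CuspForms.

(* Main.v *)
Require Import Defs.
From mathcomp Require Import all_boot all_order all_algebra.
From mathcomp Require Import finmap.
From mathcomp Require Import all_classical all_reals all_analysis.
From mathcomp Require Import measurable_realfun.
From mathcomp Require Import complex ring lra zify.

Set Implicit Arguments.
Unset Strict Implicit.
Unset Printing Implicit Defensive.

Import Order.TTheory GRing.Theory Num.Theory.
Import numFieldNormedType.Exports.
Import ComplexField.Normc.

Local Open Scope classical_set_scope.
Local Open Scope ring_scope.
Local Open Scope complex_scope.

(** Let f_1, ..., f_d be an orthonormal basis of the cusp forms of weight 2k.
    If P is a cusp form and P = sum_j a_j f_j, then Cauchy-Schwarz and Parseval
    give, at every point z = x + iy,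
      |P(z)|^2 y^(2k) <= |P|^2 S_k(z),
    where |P| is the Petersson norm ([S_Gamma_extremal], [parseval]). One cusp
    form whose mass is concentrated near one height is therefore enough.

    The test form is the first Poincare series
      P(z) = sum over coprime (c,d) of (cz+d)^(-2k) e(gamma z),
    with e(z) = exp(2 pi i z) and gamma in SL_2(Z) of bottom row (c,d). It is a
    cusp form ([poincare_cusp_form]). The two terms with c = 0 add up to 2e(z),
    and on the fundamental domain all the others together are at most
    C y^(4-2k), uniformly in k ([poincare_leading]).

    The function |e(z)|^2 y^(2k) = y^(2k) exp(-4 pi y) is maximal at
    y_0 = k/(2 pi), with value A = (y_0/exp 1)^(2k), and A dwarfs the remainder,
    which is only exponential in k. Hence |P(i y_0)|^2 y_0^(2k) >= A
    ([poincare_lower]), while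
      |P|^2 <= 8 (2k-2)!/(4 pi)^(2k-1) + O(2^k)
    ([poincare_norm_le]); the factorial is the integral of y^(2k-2) exp(-4 pi y).
    By Stirling's upper bound the right-hand side is O(A k^(-3/2))
    ([gamma_factor_le], [tail_factor_le]). So S_k(i y_0) >= c k^(3/2) for all
    large k, which is stronger than the exponent 3/2 - eps. *)

(** * The modulus of a complex number as a real number *)

Section ComplexModulus.
Variable R : realType.
Implicit Types (z w : R[i]) (x y t e : R).

Lemma normE z : `|z| = (normc z)%:C. Proof. by []. Qed.

Lemma normc_ge0 z : 0 <= normc z.
Proof. by case: z => a b; exact: sqrtr_ge0. Qed.

Lemma normc_eq0 z : (normc z == 0) = (z == 0).
Proof. by apply/eqP/eqP => [/eq0_normc//|->]; exact: normc0. Qed.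

Lemma normc_gt0 z : (0 < normc z) = (z != 0).
Proof. by rewrite lt_def normc_ge0 andbT normc_eq0. Qed.

Lemma ler_normcD z w : normc (z + w) <= normc z + normc w.
Proof. exact: le_normcD. Qed.

Lemma ler_normcB z w : normc (z - w) <= normc z + normc w.
Proof. by rewrite -(normcN w) ler_normcD. Qed.

Lemma normcX z n : normc (z ^+ n) = normc z ^+ n.
Proof. by elim: n => [|n IH]; rewrite ?expr0 ?normc1// !exprS normcM IH. Qed.

Lemma normcR x : normc x%:C = `|x|.
Proof. by rewrite /= expr0n/= addr0 sqrtr_sqr. Qed.

Lemma normcI : normc 'i%C = 1 :> R.
Proof. by rewrite /= expr0n/= add0r expr1n sqrtr1. Qed.

Lemma normc_sqr z : normc z ^+ 2 = complex.Re z ^+ 2 + complex.Im z ^+ 2.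
Proof. by case: z => a b; rewrite sqr_sqrtr// addr_ge0 ?sqr_ge0. Qed.

Lemma Re_le_normc z : `|complex.Re z| <= normc z.
Proof. by rewrite -lecR; exact: normc_ge_Re. Qed.

Lemma Im_le_normc z : `|complex.Im z| <= normc z.
Proof.
rewrite -(@ler_sqr _ _ (normc z)) ?nnegrE ?normc_ge0// normc_sqr real_normK ?num_real//.
by rewrite lerDr sqr_ge0.
Qed.

Lemma normc_le_ReIm z : normc z <= `|complex.Re z| + `|complex.Im z|.
Proof.
rewrite {1}(complexE z) (le_trans (ler_normcD _ _))// normcM normcI mul1r.
by rewrite !normcR.
Qed.

Lemma normc_sum (I : Type) (r : seq I) (P : pred I) (F : I -> R[i]) :
  normc (\sum_(i <- r | P i) F i) <= \sum_(i <- r | P i) normc (F i).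
Proof.
elim/big_ind2: _ => [|a b c d h1 h2|//]; first by rewrite normc0.
exact: le_trans (ler_normcD _ _) (lerD h1 h2).
Qed.

End ComplexModulus.

(** * Unordered sums of complex families *)

Section UnorderedSums.
Variables (R : realType) (I : choiceType).
Implicit Types (u v : I -> R[i]) (s t : R[i]).

(** Summation along finite subsets: it does not depend on an ordering of the
    index set, so a bijection of the indices can be applied term by term. *)
Definition has_sum u s := forall e : R, 0 < e ->
  exists A : {fset I}, forall B : {fset I}, (A `<=` B)%fset ->
    normc (\sum_(i <- B) u i - s) <= e.

Lemma has_sum_unique u s t : has_sum u s -> has_sum u t -> s = t.
Proof.
move=> us ut; apply/eqP; rewrite -subr_eq0 -normc_eq0 eq_le normc_ge0 andbT.
apply/ler_addgt0Pl => e e0; rewrite addr0.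
have e20 : 0 < e / 2 by rewrite divr_gt0.
have [A hA] := us _ e20; have [B hB] := ut _ e20.
have {}hA := hA (A `|` B)%fset (fsubsetUl _ _).
have {}hB := hB (A `|` B)%fset (fsubsetUr _ _).
set S := \sum_(i <- _) _ in hA hB.
have -> : s - t = (S - t) - (S - s) by ring.
by rewrite (le_trans (ler_normcB _ _))// [leRHS]splitr lerD.
Qed.

Lemma has_sumD u v s t :
  has_sum u s -> has_sum v t -> has_sum (fun i => u i + v i) (s + t).
Proof.
move=> us vt e e0; have e20 : 0 < e / 2 by rewrite divr_gt0.
have [A hA] := us _ e20; have [B hB] := vt _ e20.
exists (A `|` B)%fset => C; rewrite fsubUset => /andP[AC BC].
rewrite big_split/=.
set S := \sum_(i <- C) u i; set T := \sum_(i <- C) v i.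
have -> : S + T - (s + t) = (S - s) + (T - t) by ring.
by rewrite (le_trans (ler_normcD _ _))// [leRHS]splitr lerD ?hA ?hB.
Qed.

Lemma has_sumZ c u s : has_sum u s -> has_sum (fun i => c * u i) (c * s).
Proof.
move=> us e e0.
have c0 : 0 < normc c + 1 by rewrite ltr_wpDl ?normc_ge0.
have [A hA] := us _ (divr_gt0 e0 c0).
exists A => B AB; rewrite -mulr_sumr -mulrBr normcM.
apply: (@le_trans _ _ ((normc c + 1) * (e / (normc c + 1)))); last first.
  by rewrite mulrC divfK// gt_eqF.
by rewrite ler_pM ?normc_ge0 ?hA// lerDl.
Qed.

Lemma has_sumB u v s t :
  has_sum u s -> has_sum v t -> has_sum (fun i => u i - v i) (s - t).
Proof.
move=> us vt; rewrite -mulN1r.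
have := has_sumD us (has_sumZ (-1) vt).
by under eq_fun do rewrite mulN1r.
Qed.

Lemma normc_has_sum_le u s (M : R) : has_sum u s ->
  (forall A : {fset I}, \sum_(i <- A) normc (u i) <= M) -> normc s <= M.
Proof.
move=> us uM; apply/ler_addgt0Pl => e e0.
have [A hA] := us _ e0; have {}hA := hA A (fsubset_refl _).
set S := \sum_(i <- A) u i in hA.
have -> : s = S - (S - s) by ring.
rewrite (le_trans (ler_normcB _ _))// addrC lerD//.
exact: le_trans (normc_sum _ _ _) (uM _).
Qed.

Lemma has_sum_reindex (f g : I -> I) u s : cancel f g -> cancel g f ->
  has_sum u s -> has_sum (u \o f) s.
Proof.
move=> fK gK us e e0; have [A hA] := us _ e0.
exists [fset g x | x in A]%fset => B AB.
have := hA [fset f x | x in B]%fset.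
rewrite big_imfset/=; last by move=> x y _ _; apply: can_inj fK _ _.
apply; apply/fsubsetP => x xA; apply/imfsetP; exists (g x); last by rewrite gK.
by apply: (fsubsetP AB); apply/imfsetP; exists x.
Qed.

Lemma has_sum_finsupp u (A : {fset I}) : (forall i, i \notin A -> u i = 0) ->
  has_sum u (\sum_(i <- A) u i).
Proof.
move=> u0 e e0; exists A => B AB.
rewrite (big_fset_incl _ AB)//; first by rewrite subrr normc0 ltW.
by move=> i _ /u0.
Qed.

(** The sum is the supremum of the finite partial sums. *)
Lemma has_sum_ge0 (w : I -> R) (M : R) : (forall i, 0 <= w i) ->
  (forall A : {fset I}, \sum_(i <- A) w i <= M) ->
  exists s : R, has_sum (fun i => (w i)%:C) s%:C.
Proof.
move=> w0 wM; pose S := [set \sum_(i <- A) w i | A in [set: {fset I}]].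
have hS : has_sup S.
  split; first by exists (\sum_(i <- fset0%fset) w i), fset0.
  by exists M => _ [A _ <-]; exact: wM.
exists (sup S) => e e0.
have [_ [A _ <-] hA] := sup_adherent e0 hS.
exists A => B AB.
rewrite -(rmorph_sum (real_complex R)) -(rmorphB (real_complex R)) normcR.
have SB : \sum_(i <- B) w i <= sup S by apply: sup_ubound; [case: hS|exists B].
have AleB : \sum_(i <- A) w i <= \sum_(i <- B) w i.
  rewrite [leRHS](big_fsetID _ (mem A))/= -[leLHS]addr0 lerD ?sumr_ge0//.
  rewrite le_eqVlt; apply/orP; left; apply/eqP; apply: eq_fbigl => i.
  by rewrite !inE/= andb_idl//; exact: (fsubsetP AB).
rewrite ler0_norm ?subr_le0//; lra.
Qed.

(** Completeness, by reduction to nonnegative families: a real family u with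
    |u| <= w is (w + u) - w, and a complex one splits into its two parts. *)
Lemma has_sum_abs u (w : I -> R) (M : R) : (forall i, normc (u i) <= w i) ->
  (forall A : {fset I}, \sum_(i <- A) w i <= M) -> exists s, has_sum u s.
Proof.
move=> uw wM.
have w0 i : 0 <= w i by exact: le_trans (normc_ge0 _) (uw i).
have part (f : I -> R) : (forall i, `|f i| <= w i) ->
    exists s : R, has_sum (fun i => (f i)%:C) s%:C.
  move=> fw; have [s hs] := has_sum_ge0 w0 wM.
  have [|A|t ht] := @has_sum_ge0 (fun i => w i + f i) (2 * M).
  - move=> i; rewrite -lerBlDr sub0r.
    by rewrite lerNl; have := fw i; rewrite ler_norml => /andP[].
  - rewrite big_split/= mulr_natl mulr2n lerD ?wM//.
    apply: le_trans (wM A); apply: ler_sum => j _.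
    exact: le_trans (ler_norm _) (fw j).
  exists (t - s); rewrite rmorphB/=.
  have := has_sumB ht hs; congr has_sum; apply/funext => i.
  by rewrite rmorphD/= addrAC subrr add0r.
have [a ha] := part (fun i => complex.Re (u i))
  (fun i => le_trans (Re_le_normc _) (uw i)).
have [b hb] := part (fun i => complex.Im (u i))
  (fun i => le_trans (Im_le_normc _) (uw i)).
exists (a%:C + 'i%C * b%:C).
have := has_sumD ha (has_sumZ 'i%C hb); congr has_sum; apply/funext => i.
by rewrite -complexE.
Qed.

End UnorderedSums.

(** * The complex exponential *)

Section RealEstimates.
Variable R : realType.
Implicit Types x t : R.

Lemma sin_sub_mvt t : 0 <= t -> exists2 c : R, 0 <= c <= t & sin t = cos c * t.
Proof.
move=> t0; have [c] := @MVT_segment R sin cos 0 t t0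
  (fun x _ => is_derive_sin x) (continuous_subspaceT (@continuous_sin R)).
by rewrite in_itv/= sin0 !subr0 => ? ?; exists c.
Qed.

Lemma cos_sub_mvt t : 0 <= t ->
  exists2 c : R, 0 <= c <= t & cos t - 1 = - sin c * t.
Proof.
move=> t0; have [c] := @MVT_segment R cos (fun x => - sin x) 0 t t0
  (fun x _ => is_derive_cos x) (continuous_subspaceT (@continuous_cos R)).
by rewrite in_itv/= cos0 !subr0 => ? ?; exists c.
Qed.

Lemma norm_sin_le t : `|sin t| <= `|t|.
Proof.
wlog t0 : t / 0 <= t.
  move=> H; have [/H//|/ltW t0] := leP 0 t.
  by rewrite -[t]opprK sinN !(normrN (- t)) normrN H// oppr_ge0.
have [c _ ->] := sin_sub_mvt t0.
by rewrite normrM ler_piMl// cos_max.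
Qed.

Lemma norm_cosB1_le t : `|cos t - 1| <= t ^+ 2.
Proof.
wlog t0 : t / 0 <= t.
  move=> H; have [/H//|/ltW t0] := leP 0 t.
  by rewrite -[t]opprK cosN (sqrrN (- t)) H// oppr_ge0.
have [c /andP[c0 ct] ->] := cos_sub_mvt t0.
rewrite normrM normrN expr2 (ger0_norm t0) ler_wpM2r//.
by rewrite (le_trans (norm_sin_le _))// ger0_norm.
Qed.

Lemma norm_sinB_le t : `|t| <= 1 -> `|sin t - t| <= t ^+ 2.
Proof.
wlog t0 : t / 0 <= t.
  move=> H t1; have [/H->//|/ltW t0] := leP 0 t.
  rewrite -[t]opprK sinN (sqrrN (- t)) -opprD normrN H ?oppr_ge0//.
  by rewrite normrN.
rewrite ger0_norm// => t1; have [c /andP[c0 ct] ->] := sin_sub_mvt t0.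
have -> : cos c * t - t = (cos c - 1) * t by ring.
rewrite normrM expr2 (ger0_norm t0) ler_wpM2r//.
rewrite (le_trans (norm_cosB1_le _))// expr2.
by rewrite (le_trans _ ct)// ler_piMl// (le_trans ct).
Qed.

(** From exp(-x) >= 1 - x, that is exp x <= 1/(1 - x) <= 1 + x + 2x^2. *)
Lemma norm_expRB_le x : `|x| <= 2^-1 -> `|expR x - 1 - x| <= 2 * x ^+ 2.
Proof.
rewrite ler_norml => /andP[xl xr].
have lo : 0 <= expR x - 1 - x by have := expR_ge1Dx x; lra.
rewrite ger0_norm//.
have x1 : 0 < 1 - x by lra.
have : expR x <= (1 - x)^-1.
  by rewrite -[x in leLHS]opprK expRN lef_pV2 ?posrE ?expR_gt0// expR_ge1Dx.
have : (1 - x)^-1 <= 1 + x + 2 * x ^+ 2.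
  rewrite -[leLHS]mul1r ler_pdivrMr//.
  have : 0 <= x ^+ 2 * (1 - 2 * x) by rewrite mulr_ge0 ?sqr_ge0//; lra.
  lra.
lra.
Qed.

End RealEstimates.

Section ComplexExp.
Variable R : realType.
Implicit Types (z w : R[i]).

Definition cexp z : R[i] :=
  (expR (complex.Re z))%:C * (cos (complex.Im z) +i* sin (complex.Im z)).

Lemma cexpD z w : cexp (z + w) = cexp z * cexp w.
Proof.
case: z w => [a b] [c d]; rewrite /cexp/= expRD cosD sinD.
by apply/eqP; rewrite eq_complex/=; apply/andP; split; apply/eqP; ring.
Qed.

Lemma normc_cexp z : normc (cexp z) = expR (complex.Re z).
Proof.
rewrite normcM normcR/= cos2Dsin2 sqrtr1 mulr1 ger0_norm//.
Qed.

Lemma cexp_imaginary (t : R) : cexp (t%:C * 'i%C) = cos t +i* sin t.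
Proof.
by rewrite /cexp ReiNIm ImiRe/= oppr0 expR0 mul1r.
Qed.

Lemma cexp_2pi_int (n : int) : cexp ((n%:~R * (pi *+ 2))%:C * 'i%C) = 1.
Proof.
have nat_case (m : nat) : cexp ((m%:R * (pi *+ 2))%:C * 'i%C) = 1.
  rewrite cexp_imaginary mulr_natl.
  have := periodicn (@cosD2pi R) m 0; have := periodicn (@sinD2pi R) m 0.
  by rewrite !add0r => -> ->; rewrite cos0 sin0.
case: n => m; first exact: nat_case.
have /(congr1 (fun z => z * cexp (((Negz m)%:~R * (pi *+ 2))%:C * 'i%C))) :=
  nat_case m.+1.
rewrite -cexpD mul1r => <-; rewrite -mulrDl -rmorphD/= NegzE -mulrDl.
by rewrite mulrNz addrN mul0r cexp_imaginary cos0 sin0.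
Qed.

Lemma cexp_taylor w : normc w <= 2^-1 -> normc (cexp w - 1 - w) <= 6 * normc w ^+ 2.
Proof.
move: (normc_ge0 w) (Re_le_normc w) (Im_le_normc w); move: (normc w) => r.
case: w => x t; rewrite [complex.Re _]/= [complex.Im _]/= => r0 xr tr r1.
have -> : cexp (x +i* t) - 1 - (x +i* t) =
   (expR x - 1 - x)%:C * (cos t +i* sin t)
   + (1 + x)%:C * ((cos t - 1) +i* (sin t - t)) + 'i%C * (x * t)%:C.
  by apply/eqP; rewrite eq_complex/=; apply/andP; split; apply/eqP; ring.
have t1 : `|t| <= 1 by lra.
have x1 : `|x| <= 2^-1 by lra.
have sq (y : R) : `|y| <= r -> y ^+ 2 <= r ^+ 2.
  by move=> yr; rewrite -real_normK ?num_real// lerXn2r// nnegrE.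
have h1 : normc ((expR x - 1 - x)%:C * (cos t +i* sin t)) <= 2 * r ^+ 2.
  rewrite normcM normcR/= cos2Dsin2 sqrtr1 mulr1.
  by rewrite (le_trans (norm_expRB_le _))// ler_wpM2l// sq.
have h2 : normc ((1 + x)%:C * ((cos t - 1) +i* (sin t - t))) <= 3 * r ^+ 2.
  rewrite normcM normcR.
  have -> : 3 * r ^+ 2 = (3 / 2) * (r ^+ 2 + r ^+ 2) by field.
  rewrite ler_pM ?normc_ge0 ?normr_ge0//.
    by rewrite ler_norml; move: x1; rewrite ler_norml; lra.
  rewrite (le_trans (normc_le_ReIm _))//= lerD//.
    by rewrite (le_trans (norm_cosB1_le _))// sq.
  by rewrite (le_trans (norm_sinB_le _))// sq.
have h3 : normc ('i%C * (x * t)%:C) <= r ^+ 2.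
  by rewrite normcM normcI mul1r normcR normrM expr2 ler_pM.
have := ler_normcD ((expR x - 1 - x)%:C * (cos t +i* sin t)
   + (1 + x)%:C * ((cos t - 1) +i* (sin t - t))) ('i%C * (x * t)%:C).
have := ler_normcD ((expR x - 1 - x)%:C * (cos t +i* sin t))
   ((1 + x)%:C * ((cos t - 1) +i* (sin t - t))).
lra.
Qed.

End ComplexExp.

(** * Second-order expansions with explicit constants *)

Section Taylor.
Variable R : realType.
Implicit Types (f g : R[i] -> R[i]) (z h D : R[i]) (r K L : R).

(** A quantitative form of complex differentiability at z. One constant K
    bounds the value, the derivative and the quadratic remainder, so that the
    property passes to products and, with summable constants, to series. *)
Definition taylor r K z f := exists D : R[i],
  [/\ normc (f z) <= K, normc D <= K &
    forall h, normc h <= r -> normc (f (z + h) - f z - h * D) <= K * normc h ^+ 2].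

Lemma taylor1 r K z : 1 <= K -> taylor r K z (fun=> 1).
Proof.
move=> K1; have K0 : 0 <= K by exact: le_trans K1.
exists 0; split; [by rewrite normc1|by rewrite normc0|].
by move=> h _; rewrite mulr0 subr0 subrr normc0 mulr_ge0// exprn_ge0 ?normc_ge0.
Qed.

Lemma taylorM r K L z f g : r <= 1 -> taylor r K z f -> taylor r L z g ->
  taylor r (6 * (K * L)) z (fun w => f w * g w).
Proof.
move=> r1 [D [fK DK fD]] [E [gL EL gE]].
have K0 : 0 <= K by exact: le_trans (normc_ge0 _) fK.
have L0 : 0 <= L by exact: le_trans (normc_ge0 _) gL.
have KL0 : 0 <= K * L by exact: mulr_ge0.
exists (f z * E + D * g z); split.
- by rewrite normcM (le_trans (ler_pM _ _ fK gL)) ?normc_ge0//; lra.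
- have := ler_normcD (f z * E) (D * g z); rewrite !normcM.
  have : normc (f z) * normc E <= K * L by rewrite ler_pM ?normc_ge0.
  have : normc D * normc (g z) <= K * L by rewrite ler_pM ?normc_ge0.
  lra.
- move=> h hr; have h0 := normc_ge0 h; set s := normc h in hr h0 *.
  have s1 : s <= 1 by exact: le_trans r1.
  have {}fD := fD h hr; have {}gE := gE h hr; rewrite -/s in fD gE.
  set F := f (z + h) - f z - h * D in fD; set G := g (z + h) - g z - h * E in gE.
  have -> : f (z + h) * g (z + h) - f z * g z - h * (f z * E + D * g z) =
      h ^+ 2 * (D * E) + F * (g z + h * E + G) + (f z + h * D) * G.
    by rewrite /F /G; ring.
  have s2 : s ^+ 2 <= 1 by rewrite exprn_ile1.
  have s20 : 0 <= s ^+ 2 by rewrite exprn_ge0.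
  have hE : normc (h * E) <= L by rewrite normcM -[L]mul1r ler_pM ?normc_ge0.
  have hD : normc (h * D) <= K by rewrite normcM -[K]mul1r ler_pM ?normc_ge0.
  have GL : normc G <= L by rewrite (le_trans gE)// ler_piMr.
  have e1 : normc (h ^+ 2 * (D * E)) <= K * L * s ^+ 2.
    by rewrite !(normcM, normcX) mulrC ler_wpM2r// ler_pM ?normc_ge0.
  have e2 : normc (F * (g z + h * E + G)) <= 3 * (K * L) * s ^+ 2.
    have -> : 3 * (K * L) * s ^+ 2 = (K * s ^+ 2) * (3 * L) by ring.
    rewrite normcM ler_pM ?normc_ge0//.
    have := ler_normcD (g z + h * E) G; have := ler_normcD (g z) (h * E); lra.
  have e3 : normc ((f z + h * D) * G) <= 2 * (K * L) * s ^+ 2.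
    have -> : 2 * (K * L) * s ^+ 2 = (2 * K) * (L * s ^+ 2) by ring.
    rewrite normcM ler_pM ?normc_ge0//.
    have := ler_normcD (f z) (h * D); lra.
  have := ler_normcD (h ^+ 2 * (D * E) + F * (g z + h * E + G)) ((f z + h * D) * G).
  have := ler_normcD (h ^+ 2 * (D * E)) (F * (g z + h * E + G)).
  lra.
Qed.

Lemma taylorX r K z f n : r <= 1 -> taylor r K z f ->
  taylor r ((6 * K) ^+ n) z (fun w => f w ^+ n).
Proof.
move=> r1 fK; elim: n => [|n IH].
  by under eq_fun do rewrite expr0; exact: taylor1.
under eq_fun do rewrite exprS.
by rewrite exprS -mulrA; exact: taylorM.
Qed.

Lemma taylor_derivable r K z f : 0 < r -> taylor r K z f ->
  derivable (f : R[i]^o -> R[i]^o) z 1.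
Proof.
move=> r0 [D [fK _ fD]].
have K0 : 0 <= K by exact: le_trans (normc_ge0 _) fK.
apply/cvg_ex; exists D; apply/cvgrPdist_le => /= e e0.
have eE : e = (complex.Re e)%:C by rewrite RRe_real// ger0_real// ltW.
have re0 : 0 < complex.Re e by rewrite -ltcR -eE.
set rho := Num.min r (complex.Re e / (K + 1)).
have K10 : 0 < K + 1 by rewrite ltr_wpDl.
have rho0 : 0 < rho by rewrite lt_min r0/= divr_gt0.
near=> h.
have h0 : h != 0 by near: h; exact: (@nbhs_dnbhs_neq R[i]^o 0).
have hrho : normc h <= rho.
  rewrite -lecR -normE; near: h.
  by apply: (@dnbhs0_le _ R[i]^o); rewrite -(ltcR 0) in rho0.
have hn0 : 0 < normc h by rewrite normc_gt0.
have hr : normc h <= r by rewrite (le_trans hrho)// ge_min lexx.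
rewrite [h *: 1]mulr1 [h^-1 *: _]mulrC [h + z]addrC.
have -> : D - (f (z + h) - f z) / h = - ((f (z + h) - f z - h * D) / h).
  by field.
rewrite normrN normE eE lecR normcM normcV ler_pdivrMr//.
rewrite (le_trans (fD _ hr))// expr2 mulrA ler_wpM2r ?normc_ge0//.
apply: (@le_trans _ _ ((K + 1) * rho)).
  by apply: ler_pM => //; [exact: normc_ge0|rewrite lerDl].
by rewrite mulrC -ler_pdivlMr// ge_min lexx orbT.
Unshelve. all: by end_near. Qed.

Lemma derivable_continuous_eps f z : derivable (f : R[i]^o -> R[i]^o) z 1 ->
  forall e : R, 0 < e -> exists2 d : R, 0 < d &
    forall w, normc (w - z) < d -> normc (f w - f z) < e.
Proof.
move=> /derivable1_diffP/differentiable_continuous /cvgrPdist_lt fz e e0.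
have /fz : 0 < e%:C :> R[i] by rewrite (ltcR 0).
rewrite -nbhs_nbhs_norm => -[d /= d0 fd].
have dE : d = (complex.Re d)%:C by rewrite RRe_real// ger0_real// ltW.
exists (complex.Re d); first by rewrite -ltcR -dE.
move=> w wz; have := fd w; rewrite /ball_/= !normE dE !ltcR.
by rewrite -(normcN (z - w)) -(normcN (f z - f w)) !opprB; exact.
Qed.

End Taylor.

(** * A summable majorant on pairs of integers *)

Section LatticeSum.
Variable R : realType.

Lemma ler_sum_fset_seq (I : choiceType) (w : I -> R) (s : seq I) (A : {fset I}) :
  (forall i, 0 <= w i) -> {subset A <= s} ->
  \sum_(i <- A) w i <= \sum_(i <- s) w i.
Proof.
move=> w0; elim: s A => [|x s IH] A As.
  by rewrite big_nil big1_seq// => i /andP[_ /As].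
rewrite big_cons; have [xA|xA] := boolP (x \in A).
  rewrite (big_fsetD1 x)//= lerD2l IH// => i.
  by rewrite !inE => /andP[/negbTE ix /As]; rewrite inE ix.
rewrite -[leLHS]add0r lerD// IH// => i iA.
by have := As _ iA; rewrite inE => /orP[/eqP ix|//]; rewrite -ix iA in xA.
Qed.

Definition inv_sq_weight (n : int) : R := ((1 + `|n|%N%:R) ^+ 2)^-1.

Lemma inv_sq_weight_ge0 n : 0 <= inv_sq_weight n.
Proof. by rewrite invr_ge0 exprn_ge0// addr_ge0. Qed.

(** Telescoping: 1/(n+1)^2 <= 2/(n+1) - 2/(n+2). The map f is n |-> n or
    n |-> -(n+1), which together enumerate the integers. *)
Lemma sum_inv_sq_weight N (f : nat -> int) : (forall n, n <= `|f n|)%N ->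
  \sum_(n <- iota 0 N) inv_sq_weight (f n) <= 2.
Proof.
move=> fn; apply: (@le_trans _ _ (2 - 2 / N.+1%:R)); last first.
  by rewrite gerBl divr_ge0.
elim: N => [|N IH]; first by rewrite big_nil divr1 subrr.
rewrite -addn1 iotaD big_cat/= big_cons big_nil addr0 addn1 add0n.
have x0 : 0 <= N%:R :> R by [].
have h1 : inv_sq_weight (f N) <= ((1 + N%:R) ^+ 2)^-1.
  rewrite lef_pV2 ?posrE ?exprn_gt0 ?ltr_pwDl// lerXn2r ?nnegrE ?addr_ge0//.
  by rewrite lerD2l ler_nat.
move: IH h1; rewrite -[N.+2%:R]natr1 -[N.+1%:R]natr1; move: (N%:R) x0 => x x0.
have h2 : ((1 + x) ^+ 2)^-1 <= 2 / (x + 1) - 2 / (x + 1 + 1).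
  rewrite -subr_ge0.
  have -> : 2 / (x + 1) - 2 / (x + 1 + 1) - ((1 + x) ^+ 2)^-1
     = x / ((x + 1) ^+ 2 * (x + 1 + 1)) by field; apply/andP; split; lra.
  by rewrite divr_ge0// mulr_ge0 ?exprn_ge0//; lra.
lra.
Qed.

(** A product majorant of (|c| + |d|)^(-4), hence a double sum of product
    form; the factor 16 comes from 1 + |c| <= 2(|c| + |d|) off the origin. *)
Definition lattice_weight (p : int * int) : R :=
  16 * (inv_sq_weight p.1 * inv_sq_weight p.2).

Lemma lattice_weight_ge0 p : 0 <= lattice_weight p.
Proof. by rewrite !mulr_ge0 ?inv_sq_weight_ge0. Qed.

Lemma sum_lattice_weight (A : {fset int * int}) :
  \sum_(p <- A) lattice_weight p <= 256.
Proof.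
pose N := (\max_(p <- A) (`|p.1| + `|p.2|)).+1.
pose s : seq int := map Posz (iota 0 N) ++ map Negz (iota 0 N).
have sP (n : int) : (`|n| < N)%N -> n \in s.
  rewrite mem_cat; case: n => n nN; apply/orP; [left|right].
    by apply/mapP; exists n => //; rewrite mem_iota add0n.
  by apply/mapP; exists n => //; rewrite mem_iota add0n; apply: ltnW.
have s4 : \sum_(n <- s) inv_sq_weight n <= 4.
  rewrite big_cat !big_map/=.
  have := @sum_inv_sq_weight N Posz (fun=> leqnn _).
  have := @sum_inv_sq_weight N Negz (fun=> leqnSn _).
  lra.
have s0 : 0 <= \sum_(n <- s) inv_sq_weight n.
  by rewrite sumr_ge0// => n _; exact: inv_sq_weight_ge0.
apply: (@le_trans _ _ (\sum_(p <- [seq (c, d) | c <- s, d <- s]) lattice_weight p)).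
  apply: ler_sum_fset_seq => [p|[c d] pA]; first exact: lattice_weight_ge0.
  have cdN : (`|c| + `|d| < N)%N.
    by rewrite ltnS (@leq_bigmax_seq _ (enum_fset A) xpredT
      (fun p => (`|p.1| + `|p.2|)%N) _ pA isT).
  by apply: (allpairs_f pair); apply: sP; apply: leq_ltn_trans cdN; rewrite (leq_addr, leq_addl).
rewrite big_allpairs /lattice_weight /=.
under eq_bigr do rewrite -mulr_sumr -mulr_sumr.
rewrite -mulr_sumr -mulr_suml.
have : (\sum_(n <- s) inv_sq_weight n) * (\sum_(n <- s) inv_sq_weight n) <= 4 * 4.
  by rewrite ler_pM.
lra.
Qed.

Lemma lattice_weight_lower (p : int * int) : p != 0 ->
  (`|p.1|%N%:R + `|p.2|%N%:R : R) ^- 4 <= lattice_weight p.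
Proof.
case: p => c d p0; rewrite /lattice_weight /inv_sq_weight/=.
have lam1 : 1 <= `|c|%N%:R + `|d|%N%:R :> R.
  rewrite -natrD (ler_nat _ 1) lt0n addn_eq0 !absz_eq0.
  by apply: contra p0 => /andP[/eqP-> /eqP->].
have : 0 <= `|c|%N%:R :> R by []. have : 0 <= `|d|%N%:R :> R by [].
move: (`|c|%N%:R) (`|d|%N%:R) lam1 => x y lam1 y0 x0.
rewrite -invfM; set Z := (1 + x) ^+ 2 * _.
have Z0 : 0 < Z by rewrite mulr_gt0// exprn_gt0//; lra.
rewrite ler_pdivlMr// mulrC ler_pdivrMr ?exprn_gt0//; last lra.
have -> : 16 * (x + y) ^+ 4 = (2 * (x + y)) ^+ 2 * (2 * (x + y)) ^+ 2 by ring.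
by rewrite ler_pM ?exprn_ge0// ?lerXn2r ?nnegrE//; lra.
Qed.

End LatticeSum.

(** * The terms of the Poincare series *)

Section PoincareSeries.
Variable R : realType.
Implicit Types (z w : R[i]) (p q : int * int) (k : nat).

Definition linform p z : R[i] := p.1%:~R * z + p.2%:~R.

Definition qexp z : R[i] := cexp ((pi *+ 2)%:C * 'i%C * z).

Lemma qexpD_int z (n : int) : qexp (z + n%:~R) = qexp z.
Proof.
rewrite /qexp mulrDr cexpD -[RHS]mulr1; congr (_ * _).
apply: etrans (cexp_2pi_int R n); congr cexp.
by rewrite rmorphM/= rmorph_int; ring.
Qed.

Lemma normc_qexp z : normc (qexp z) = expR (- (pi *+ 2 * complex.Im z)).
Proof.
rewrite normc_cexp; congr expR; case: z => x y /=.
by ring.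
Qed.

(** The top row of some matrix of SL_2(Z) with bottom row p, from Bezout. *)
Definition cofactor_row p : int * int :=
  let e := egcdz p.2 p.1 in (e.1, - e.2).

Definition pdet q p : int := q.1 * p.2 - q.2 * p.1.

Lemma pdet_cofactor_row p : coprimez p.1 p.2 -> pdet (cofactor_row p) p = 1.
Proof.
rewrite /pdet /cofactor_row /coprimez gcdzC.
case: egcdzP => u v /= <- _ /eqP <-; ring.
Qed.

Lemma coprime_pdet q p : pdet q p = 1 -> coprimez p.1 p.2.
Proof.
rewrite /pdet => h; apply/coprimezP; exists (- q.2, q.1) => /=.
by rewrite -h; ring.
Qed.

Lemma Im_ratio (u v : R[i]) : complex.Im (u / v) =
  (complex.Im u * complex.Re v - complex.Re u * complex.Im v) / normc v ^+ 2.
Proof.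
rewrite normc_sqr; case: u v => [a b] [c d] /=; ring.
Qed.

Lemma Re_linform p z : complex.Re (linform p z) = p.1%:~R * complex.Re z + p.2%:~R.
Proof.
rewrite /linform -!(rmorph_int (real_complex R)); case: z => x y /=; ring.
Qed.

Lemma Im_linform p z : complex.Im (linform p z) = p.1%:~R * complex.Im z.
Proof.
rewrite /linform -!(rmorph_int (real_complex R)); case: z => x y /=; ring.
Qed.

(** Im(gamma z) = y/|cz+d|^2. *)
Lemma Im_linform_ratio q p z : pdet q p = 1 ->
  complex.Im (linform q z / linform p z) = complex.Im z / normc (linform p z) ^+ 2.
Proof.
move=> /(congr1 (fun n : int => n%:~R : R)); rewrite /pdet rmorphB !rmorphM/= => h.
rewrite Im_ratio !Re_linform !Im_linform; congr (_ / _).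
transitivity ((q.1%:~R * p.2%:~R - q.2%:~R * p.1%:~R) * complex.Im z); first ring.
by rewrite h mul1r.
Qed.

Definition height p : R := `|p.1|%N%:R + `|p.2|%N%:R.

(** The constant of proportionality in |cz+d| >= margin z * (|c| + |d|). *)
Definition margin z : R := complex.Im z / (1 + complex.Im z + normc z).

Lemma margin_gt0 z : 0 < complex.Im z -> 0 < margin z.
Proof. by move=> y0; rewrite divr_gt0// ltr_wpDr ?normc_ge0// addr_gt0. Qed.

Lemma margin_le1 z : 0 < complex.Im z -> margin z <= 1.
Proof.
move=> y0; have n0 := normc_ge0 z.
by rewrite ler_pdivrMr ?mul1r; lra.
Qed.

Lemma normr_int_absz (n : int) : `|n%:~R| = `|n|%N%:R :> R.
Proof. by rewrite -intr_norm -abszE. Qed.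

Lemma normc_int (n : int) : normc (n%:~R : R[i]) = `|n|%N%:R.
Proof. by rewrite -(rmorph_int (real_complex R)) normcR normr_int_absz. Qed.

(** Im(cz+d) = cy controls |c|, and |d| <= |cz+d| + |c||z| then controls |d|. *)
Lemma linform_lower p z : 0 < complex.Im z ->
  margin z * height p <= normc (linform p z).
Proof.
move=> y0; have n0 := normc_ge0 z.
rewrite /margin mulrAC ler_pdivrMr; last lra.
have h1 : `|p.1|%N%:R * complex.Im z <= normc (linform p z).
  have := Im_le_normc (linform p z).
  by rewrite Im_linform normrM normr_int_absz gtr0_norm.
have h2 : `|p.2|%N%:R <= normc (linform p z) + `|p.1|%N%:R * normc z.
  rewrite -!normc_int -normcM.
  have -> : (p.2%:~R : R[i]) = linform p z - p.1%:~R * z by rewrite /linform; ring.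
  exact: ler_normcB.
have : complex.Im z * `|p.2|%N%:R <=
  complex.Im z * (normc (linform p z) + `|p.1|%N%:R * normc z) by rewrite ler_pM2l.
have : `|p.1|%N%:R * complex.Im z * normc z <= normc (linform p z) * normc z.
  by rewrite ler_wpM2r.
rewrite /height; nra.
Qed.

Lemma height_ge1 p : p != 0 -> 1 <= height p.
Proof.
case: p => c d p0; rewrite /height -natrD (ler_nat _ 1) lt0n addn_eq0 !absz_eq0.
by apply: contra p0 => /andP[/eqP/= -> /eqP/= ->].
Qed.

Lemma coprime_neq0 p : coprimez p.1 p.2 -> p != 0.
Proof. by apply: contraTneq => ->. Qed.

Lemma linform_neq0 p z : 0 < complex.Im z -> p != 0 -> linform p z != 0.
Proof.
move=> y0 p0; rewrite -normc_gt0 (lt_le_trans _ (linform_lower p y0))//.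
by rewrite mulr_gt0 ?margin_gt0// (lt_le_trans ltr01)// height_ge1.
Qed.

Definition poincare_term k z p : R[i] :=
  if coprimez p.1 p.2 then
    qexp (linform (cofactor_row p) z / linform p z) / linform p z ^+ (2 * k)
  else 0.

(** The choice of the top row does not matter: two choices differ by an integer
    multiple n of the bottom row, which translates gamma z by n. *)
Lemma poincare_termE k z q p : 0 < complex.Im z -> pdet q p = 1 ->
  poincare_term k z p = qexp (linform q z / linform p z) / linform p z ^+ (2 * k).
Proof.
move=> y0 qp; have cp := coprime_pdet qp; rewrite /poincare_term cp.
congr (_ / _); set q0 := cofactor_row p.
have q0p : pdet q0 p = 1 by exact: pdet_cofactor_row.
(* The determinant of the two top rows: it solves q = q0 + n p. *)
pose n := q0.1 * q.2 - q0.2 * q.1.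
have e1 : q.1 = q0.1 + n * p.1.
  have := congr1 (fun t => t * q.1) q0p; have := congr1 (fun t => t * q0.1) qp.
  rewrite /pdet /n; lia.
have e2 : q.2 = q0.2 + n * p.2.
  have := congr1 (fun t => t * q.2) q0p; have := congr1 (fun t => t * q0.2) qp.
  rewrite /pdet /n; lia.
move: n e1 e2 => n e1 e2; have lf0 := linform_neq0 y0 (coprime_neq0 cp).
have -> : linform q z / linform p z = linform q0 z / linform p z + n%:~R.
  have -> : linform q z = linform q0 z + n%:~R * linform p z.
    by rewrite /linform e1 e2 !intrD !intrM; ring.
  by rewrite mulrDl mulfK.
by rewrite qexpD_int.
Qed.

Lemma normc_qexp_le1 z : 0 <= complex.Im z -> normc (qexp z) <= 1.
Proof.
move=> y0; rewrite normc_qexp -expR0 ler_expR oppr_le0 mulr_ge0//.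
by rewrite mulrn_wge0// pi_ge0.
Qed.

Lemma normc_poincare_term k z p : 0 < complex.Im z -> coprimez p.1 p.2 ->
  normc (poincare_term k z p) <= normc (linform p z) ^- (2 * k).
Proof.
move=> y0 cp; rewrite (poincare_termE _ y0 (pdet_cofactor_row cp)).
rewrite normcM normcV normcX ler_piMl ?invr_ge0 ?exprn_ge0 ?normc_ge0//.
apply: normc_qexp_le1; rewrite Im_linform_ratio ?pdet_cofactor_row//.
by rewrite divr_ge0 ?exprn_ge0 ?normc_ge0// ltW.
Qed.

End PoincareSeries.

(** * Convergence and modularity *)

Section PoincareSum.
Variable R : realType.
Implicit Types (z w : R[i]) (p q : int * int) (k : nat).

Lemma poincare_term_0 k z p : ~~ coprimez p.1 p.2 -> poincare_term k z p = 0.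
Proof. by rewrite /poincare_term => /negbTE ->. Qed.

Lemma height_weight k p : (2 <= k)%N -> p != 0 ->
  (height R p) ^- (2 * k) <= lattice_weight R p.
Proof.
move=> k2 p0; apply: le_trans (lattice_weight_lower R p0).
have h1 := height_ge1 R p0.
rewrite lef_pV2 ?posrE ?exprn_gt0 ?(lt_le_trans ltr01)//.
by rewrite ler_weXn2l//; lia.
Qed.

Lemma poincare_term_bound k z p : (2 <= k)%N -> 0 < complex.Im z ->
  normc (poincare_term k z p) <= margin z ^- (2 * k) * lattice_weight R p.
Proof.
move=> k2 y0; have m0 := margin_gt0 y0.
have [cp|cp] := boolP (coprimez p.1 p.2); last first.
  rewrite poincare_term_0// normc0 mulr_ge0 ?lattice_weight_ge0//.
  by rewrite invr_ge0 exprn_ge0// ltW.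
have p0 := coprime_neq0 cp.
have h1 : 0 < height R p by rewrite (lt_le_trans ltr01)// height_ge1.
apply: le_trans (normc_poincare_term k y0 cp) _.
apply: (@le_trans _ _ ((margin z * height R p) ^- (2 * k))).
  have mh : 0 < margin z * height R p by exact: mulr_gt0.
  rewrite lef_pV2 ?posrE ?(exprn_gt0 _ mh) ?exprn_gt0 ?normc_gt0 ?linform_neq0//.
  by rewrite lerXn2r ?nnegrE ?normc_ge0 ?linform_lower// ltW.
rewrite exprMn invfM ler_wpM2l ?height_weight//.
by rewrite invr_ge0 exprn_ge0// ltW.
Qed.

Definition poincare k z : R[i] := xget 0 [set s | has_sum (poincare_term k z) s].

Lemma poincare_has_sum k z : (2 <= k)%N -> 0 < complex.Im z ->
  has_sum (poincare_term k z) (poincare k z).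
Proof.
move=> k2 y0; have m0 := margin_gt0 y0.
have [|s hs] := @has_sum_abs _ _ _ _ (margin z ^- (2 * k) * 256)
    (fun p => poincare_term_bound p k2 y0).
  move=> A; rewrite -mulr_sumr ler_wpM2l ?sum_lattice_weight//.
  by rewrite invr_ge0 exprn_ge0// ltW.
by rewrite /poincare; case: xgetP => [t _ //|/(_ s)].
Qed.

Lemma det_22 (g : 'M[int]_2) : \det g = g 0 0 * g 1 1 - g 0 1 * g 1 0.
Proof.
rewrite (expand_det_row _ 0) big_ord_recl big_ord1 /cofactor !det_mx11 !mxE/=.
have -> : lift 0 (0 : 'I_1) = 1 :> 'I_2 by apply/val_inj.
have -> : lift 1 (0 : 'I_1) = 0 :> 'I_2 by apply/val_inj.
by rewrite /= expr0 expr1 mul1r mulN1r mulrN.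
Qed.

(** The row vector p times the matrix g. *)
Definition row_act (g : 'M[int]_2) p : int * int :=
  (p.1 * g 0 0 + p.2 * g 1 0, p.1 * g 0 1 + p.2 * g 1 1).

(** The row vector p times the adjugate of g. *)
Definition row_act_inv (g : 'M[int]_2) p : int * int :=
  (p.1 * g 1 1 - p.2 * g 1 0, p.2 * g 0 0 - p.1 * g 0 1).

Lemma row_actK g : \det g = 1 -> cancel (row_act g) (row_act_inv g).
Proof.
rewrite det_22 => g1 [a b]; rewrite /row_act /row_act_inv/=.
by congr (_, _); rewrite -[RHS]mulr1 -g1; ring.
Qed.

Lemma row_act_invK g : \det g = 1 -> cancel (row_act_inv g) (row_act g).
Proof.
rewrite det_22 => g1 [a b]; rewrite /row_act /row_act_inv/=.
by congr (_, _); rewrite -[RHS]mulr1 -g1; ring.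
Qed.

Lemma pdet_row_act g q p : pdet (row_act g q) (row_act g p) = pdet q p * \det g.
Proof. by rewrite det_22 /pdet /row_act/=; ring. Qed.

Lemma coprime_row_act g p : \det g = 1 ->
  coprimez (row_act g p).1 (row_act g p).2 = coprimez p.1 p.2.
Proof.
move=> g1; apply/idP/idP => cp.
  have h := pdet_cofactor_row cp; apply: (@coprime_pdet
    (row_act_inv g (cofactor_row (row_act g p)))).
  have := pdet_row_act g (row_act_inv g (cofactor_row (row_act g p))) p.
  by rewrite row_act_invK// h g1 mulr1.
apply: (@coprime_pdet (row_act g (cofactor_row p))).
by rewrite pdet_row_act pdet_cofactor_row// g1.
Qed.

Lemma denomE g z : denom g z = linform (g 1 0, g 1 1) z.
Proof. by []. Qed.

Lemma denom_neq0 g z : \det g = 1 -> 0 < complex.Im z -> denom g z != 0.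
Proof.
move=> g1 y0; rewrite denomE linform_neq0//.
by apply: contra_eqN g1 => /eqP[h0 h1]; rewrite det_22 h0 h1 !mulr0 subrr.
Qed.

Lemma linform_moebius g p z : denom g z != 0 ->
  linform p (moebius g z) = linform (row_act g p) z / denom g z.
Proof.
move=> d0; rewrite /moebius /linform /row_act/= !intrD !intrM.
by move: d0; rewrite /denom => d0; field.
Qed.

Lemma Im_moebius_gt0 g z : \det g = 1 -> 0 < complex.Im z ->
  0 < complex.Im (moebius g z).
Proof.
move=> g1 y0; have d0 := denom_neq0 g1 y0.
have : pdet (g 0 0, g 0 1) (g 1 0, g 1 1) = 1 by rewrite -g1 det_22.
move=> /(Im_linform_ratio z).
rewrite -denomE => ->; by rewrite divr_gt0// exprn_gt0// normc_gt0.
Qed.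

(** If q is a top row for p, then q g is one for p g, and
    p (gz, 1)^T = (p g)(z, 1)^T / denom g z. *)
Lemma poincare_term_moebius k g z p : \det g = 1 -> 0 < complex.Im z ->
  poincare_term k (moebius g z) p =
  denom g z ^+ (2 * k) * poincare_term k z (row_act g p).
Proof.
move=> g1 y0; have d0 := denom_neq0 g1 y0.
have [cp|cp] := boolP (coprimez p.1 p.2); last first.
  by rewrite !poincare_term_0 ?mulr0// coprime_row_act.
have qp := pdet_cofactor_row cp.
have gqp : pdet (row_act g (cofactor_row p)) (row_act g p) = 1.
  by rewrite pdet_row_act qp g1.
rewrite (poincare_termE _ (Im_moebius_gt0 g1 y0) qp) (poincare_termE _ y0 gqp).
have l0 : linform (row_act g p) z != 0.
  by rewrite linform_neq0// coprime_neq0// coprime_row_act.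
rewrite !linform_moebius// expr_div_n.
have -> : linform (row_act g (cofactor_row p)) z / denom g z /
    (linform (row_act g p) z / denom g z) =
    linform (row_act g (cofactor_row p)) z / linform (row_act g p) z.
  by field; apply/andP.
by rewrite invf_div mulrCA.
Qed.

(** The substitution p |-> p g permutes the terms up to the automorphy factor. *)
Lemma poincare_modular k : (2 <= k)%N -> modular_invariant k (poincare k).
Proof.
move=> k2 g g1 z y0.
apply: has_sum_unique (poincare_has_sum k2 (Im_moebius_gt0 g1 y0)) _.
have := has_sumZ (denom g z ^+ (2 * k)) (has_sum_reindex (row_actK g1)
  (row_act_invK g1) (poincare_has_sum k2 y0)).
by congr has_sum; apply/funext => p; rewrite /= poincare_term_moebius.
Qed.

End PoincareSum.

(** * Holomorphy of the Poincare series *)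

Section SeriesTaylor.
Variables (R : realType) (I : choiceType).

(** The derivatives have a sum by comparison, and the remainder of the sum is
    the sum of the remainders. *)
Lemma taylor_has_sum (u : R[i] -> I -> R[i]) (S : R[i] -> R[i]) (z : R[i])
    (r C M : R) (w : I -> R) : 0 <= r -> 0 <= C ->
  (forall i, taylor r (C * w i) z (fun x => u x i)) ->
  (forall A : {fset I}, \sum_(i <- A) w i <= M) ->
  (forall h, normc h <= r -> has_sum (u (z + h)) (S (z + h))) ->
  taylor r (C * M) z S.
Proof.
move=> r0 C0 uw wM uS.
have [D hD] := @choice _ _ (fun i D => [/\ normc (u z i) <= C * w i,
  normc D <= C * w i & forall h, normc h <= r ->
  normc (u (z + h) i - u z i - h * D) <= C * w i * normc h ^+ 2]) uw.
have CwM (A : {fset I}) : \sum_(i <- A) C * w i <= C * M.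
  by rewrite -mulr_sumr ler_wpM2l.
have us : has_sum (u z) (S z) by have := uS 0; rewrite normc0 addr0 => /(_ r0).
have [d hd] : exists d, has_sum D d.
  by apply: (has_sum_abs _ CwM) => i; case: (hD i).
exists d; split.
- apply: (normc_has_sum_le us) => A; apply: le_trans (CwM A).
  by apply: ler_sum => i _; case: (hD i).
- apply: (normc_has_sum_le hd) => A; apply: le_trans (CwM A).
  by apply: ler_sum => i _; case: (hD i).
- move=> h hr.
  apply: (normc_has_sum_le (has_sumB (has_sumB (uS _ hr) us) (has_sumZ h hd))) => A.
  apply: (@le_trans _ _ (\sum_(i <- A) C * w i * normc h ^+ 2)).
    by apply: ler_sum => i _; case: (hD i) => _ _; exact.
  by rewrite -mulr_suml ler_wpM2r ?CwM// exprn_ge0// normc_ge0.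
Qed.

End SeriesTaylor.

Section PoincareHolomorphic.
Variable R : realType.
Implicit Types (z w h : R[i]) (p q : int * int) (k : nat).

(** For |w - z| <= taylor_radius z, every |cw+d| is at least half of
    margin z * (|c| + |d|), and the exponent of e(gamma w)/e(gamma z) is at most
    1/2 in modulus, whatever the bottom row (c,d). *)
Definition taylor_radius z : R := margin z ^+ 2 / 32.

Lemma taylor_radius_le z : 0 < complex.Im z -> taylor_radius z <= margin z / 2.
Proof.
move=> y0; have := margin_le1 y0; have := margin_gt0 y0; rewrite /taylor_radius.
by move: (margin z) => m m0 m1; nra.
Qed.

Let linform_shift p z h : linform p (z + h) = linform p z + p.1%:~R * h.
Proof. by rewrite /linform; ring. Qed.

Let fst_le_height p : normc (p.1%:~R : R[i]) <= height R p.
Proof. by rewrite normc_int lerDl. Qed.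

Let linform_near p z h : 0 < complex.Im z -> normc h <= taylor_radius z ->
  margin z * height R p / 2 <= normc (linform p (z + h)).
Proof.
move=> y0 hr; have m0 := margin_gt0 y0.
have h0 : 0 <= height R p by rewrite addr_ge0.
have h1 := linform_lower p y0.
have -> : linform p (z + h) = linform p z - (- (p.1%:~R * h)).
  by rewrite linform_shift opprK.
have : normc (linform p z) <= normc (linform p z - (- (p.1%:~R * h))) + normc (- (p.1%:~R * h)).
  by rewrite -{1}(subrK (- (p.1%:~R * h)) (linform p z)) ler_normcD.
rewrite normcN normcM.
have : normc (p.1%:~R : R[i]) * normc h <= height R p * (margin z / 2).
  by rewrite ler_pM ?normc_ge0// (le_trans hr)// taylor_radius_le.
lra.
Qed.

Let height_inv_linform p z : 0 < complex.Im z -> p != 0 ->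
  height R p * normc (linform p z)^-1 <= (margin z)^-1.
Proof.
move=> y0 p0; have m0 := margin_gt0 y0.
rewrite normcV ler_pdivrMr ?normc_gt0 ?linform_neq0//.
by rewrite ler_pdivlMl// linform_lower.
Qed.

Let height_inv_linform_near p z h : 0 < complex.Im z -> p != 0 ->
  normc h <= taylor_radius z ->
  linform p (z + h) != 0 /\
  height R p * normc (linform p (z + h))^-1 <= 2 * (margin z)^-1.
Proof.
move=> y0 p0 hr; have m0 := margin_gt0 y0.
have h1 := height_ge1 R p0.
have lo := linform_near p y0 hr.
have l0 : 0 < normc (linform p (z + h)).
  by apply: lt_le_trans lo; rewrite divr_gt0// mulr_gt0//; lra.
split; first by rewrite -normc_gt0.
rewrite normcV ler_pdivrMr// mulrAC ler_pdivlMr//; lra.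
Qed.

Let margin_inv_ge1 z : 0 < complex.Im z -> 1 <= (margin z)^-1.
Proof. by move=> y0; rewrite invf_ge1 ?margin_gt0 ?margin_le1. Qed.

(** The factor |c| + |d| makes the bounds independent of p; its powers are
    taken out again as the summable weight of the term. *)
Lemma taylor_height_div_linform p z : 0 < complex.Im z -> p != 0 ->
  taylor (taylor_radius z) (2 * (margin z)^-1 ^+ 3) z
    (fun w => (height R p)%:C / linform p w).
Proof.
move=> y0 p0; have r1 := margin_inv_ge1 y0.
have H1 := height_ge1 R p0; have H0 : 0 <= height R p by lra.
have HA := height_inv_linform y0 p0.
have cH := fst_le_height p.
have n0 := linform_neq0 y0 p0.
have near := height_inv_linform_near y0 p0.
move: (margin z)^-1 r1 HA near => rho r1 HA near.
have r2 : rho <= 2 * rho ^+ 3 by nra.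
have A0 := normc_ge0 (linform p z)^-1.
have cA : normc (p.1%:~R : R[i]) * normc (linform p z)^-1 <= rho.
  by apply: le_trans HA; rewrite ler_wpM2r.
have nH : normc (height R p)%:C = height R p by rewrite normcR ger0_norm.
exists (- ((height R p)%:C / linform p z) * (p.1%:~R / linform p z)); split.
- by rewrite normcM nH (le_trans HA).
- rewrite normcM normcN !normcM nH.
  have : height R p * normc (linform p z)^-1 *
    (normc (p.1%:~R : R[i]) * normc (linform p z)^-1) <= rho * rho.
    by rewrite ler_pM ?mulr_ge0 ?normc_ge0.
  by move/le_trans; apply; nra.
- move=> h hr; have [n1 HB] := near h hr.
  have B0 := normc_ge0 (linform p (z + h))^-1.
  have cB : normc (p.1%:~R : R[i]) * normc (linform p (z + h))^-1 <= 2 * rho.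
    by apply: le_trans HB; rewrite ler_wpM2r.
  have -> : (height R p)%:C / linform p (z + h) - (height R p)%:C / linform p z -
     h * (- ((height R p)%:C / linform p z) * (p.1%:~R / linform p z)) =
     ((height R p)%:C / linform p z) * (p.1%:~R / linform p z) *
     (p.1%:~R / linform p (z + h)) * h ^+ 2.
    move: n1; rewrite linform_shift => n1; by field; apply/andP.
  rewrite normcM normcX ler_wpM2r ?exprn_ge0 ?normc_ge0// !normcM nH.
  have -> : 2 * rho ^+ 3 = rho * rho * (2 * rho) by ring.
  by rewrite ler_pM// ?ler_pM// ?mulr_ge0 ?normc_ge0.
Qed.

(** Since gamma w - gamma z = (w - z)/((cz+d)(cw+d)), the quotient
    e(gamma w)/e(gamma z) is the exponential of a small number, to which
    [cexp_taylor] applies; and |e(gamma z)| <= 1. *)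
Lemma taylor_qexp_ratio q p z : 0 < complex.Im z -> pdet q p = 1 ->
  taylor (taylor_radius z) (1600 * (margin z)^-1 ^+ 4) z
    (fun w => qexp (linform q w / linform p w)).
Proof.
move=> y0 qp; have p0 := coprime_neq0 (coprime_pdet qp).
have r1 := margin_inv_ge1 y0.
have H1 := height_ge1 R p0; have H0 : 0 <= height R p by lra.
have HA := height_inv_linform y0 p0.
have cH := fst_le_height p.
have n0 := linform_neq0 y0 p0.
have near := height_inv_linform_near y0 p0.
have E1 : normc (qexp (linform q z / linform p z)) <= 1.
  apply: normc_qexp_le1; rewrite Im_linform_ratio//.
  by rewrite divr_ge0 ?exprn_ge0 ?normc_ge0// ltW.
have radE : taylor_radius z = ((margin z)^-1 ^+ 2)^-1 / 32 by rewrite exprVn invrK.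
rewrite radE; rewrite radE in near.
clear radE; move: (margin z)^-1 r1 HA near => rho r1 HA near.
move EE : (qexp (linform q z / linform p z)) E1 => E E1.
have A0 := normc_ge0 (linform p z)^-1.
have A1 : normc (linform p z)^-1 <= rho by apply: le_trans HA; rewrite ler_peMl.
have [T [T8 TE]] : exists T : R[i], normc T <= 8 /\ forall w, qexp w = cexp (T * w).
  exists ((pi *+ 2)%:C * 'i%C); split => //.
  rewrite normcM normcI normcR mulr1 ger0_norm; last first.
    by rewrite mulrn_wge0// pi_ge0.
  by have := @pihalf_lt2 R; lra.
have E0 : 0 <= normc E by exact: normc_ge0.
have T0 := normc_ge0 T.
have rho2 : 1 <= rho ^+ 2 by rewrite exprn_ege1.
exists (E * (T * ((linform p z)^-1 * (linform p z)^-1))); split.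
- rewrite EE; apply: le_trans E1 _.
  have : 1 <= rho ^+ 4 by rewrite exprn_ege1.
  lra.
- rewrite !normcM.
  have : normc E * (normc T * (normc (linform p z)^-1 * normc (linform p z)^-1))
    <= 1 * (8 * (rho * rho)) by rewrite !ler_pM ?mulr_ge0.
  move/le_trans; apply.
  have -> : rho ^+ 4 = rho ^+ 2 * rho ^+ 2 by ring.
  by rewrite -expr2; nra.
- move=> h hr; have [n1 HB] := near h hr.
  have B0 := normc_ge0 (linform p (z + h))^-1.
  have B1 : normc (linform p (z + h))^-1 <= 2 * rho.
    by apply: le_trans HB; rewrite ler_peMl.
  have cB : normc (p.1%:~R : R[i]) * normc (linform p (z + h))^-1 <= 2 * rho.
    by apply: le_trans HB; rewrite ler_wpM2r.
  pose W := T * ((linform p z)^-1 * (linform p (z + h))^-1) * h.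
  have EW : qexp (linform q (z + h) / linform p (z + h)) = E * cexp W.
    rewrite -EE !TE -cexpD; congr cexp.
    have detC : (q.1%:~R * p.2%:~R - q.2%:~R * p.1%:~R : R[i]) = 1.
      by rewrite -!intrM -intrB; have := qp; rewrite /pdet => ->.
    have key : linform q (z + h) / linform p (z + h) - linform q z / linform p z =
        (q.1%:~R * p.2%:~R - q.2%:~R * p.1%:~R) *
        ((linform p z)^-1 * (linform p (z + h))^-1 * h).
      by move: n0 n1; rewrite /linform => n0 n1; field; apply/andP.
    by rewrite detC mul1r in key; rewrite /W -mulrA -mulrDr -key addrCA subrr addr0.
  have W16 : normc W <= 16 * rho ^+ 2 * normc h.
    rewrite !normcM ler_wpM2r ?normc_ge0//.
    have -> : 16 * rho ^+ 2 = 8 * (rho * (2 * rho)) by ring.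
    by rewrite !ler_pM ?mulr_ge0.
  have Wsmall : normc W <= 2^-1.
    apply: le_trans W16 _; rewrite -ler_pdivlMl; last lra.
    by apply: le_trans hr _; rewrite invfM; lra.
  rewrite EE.
  have -> : qexp (linform q (z + h) / linform p (z + h)) - E -
      h * (E * (T * ((linform p z)^-1 * (linform p z)^-1))) =
      E * ((cexp W - 1 - W) - T * (linform p z)^-1 * (linform p z)^-1 *
          (p.1%:~R / linform p (z + h)) * h ^+ 2).
    rewrite EW /W; move: n1; rewrite linform_shift => n1; field.
    by rewrite n0 n1.
  rewrite normcM -[leRHS]mul1r ler_pM ?normc_ge0//.
  apply: le_trans (ler_normcB _ _) _.
  have h1 : normc (cexp W - 1 - W) <= 1536 * rho ^+ 4 * normc h ^+ 2.
    apply: le_trans (cexp_taylor Wsmall) _.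
    have -> : 1536 * rho ^+ 4 * normc h ^+ 2 = 6 * (16 * rho ^+ 2 * normc h) ^+ 2.
      by ring.
    rewrite ler_wpM2l// lerXn2r ?nnegrE ?normc_ge0//.
    by rewrite !mulr_ge0 ?normc_ge0//; lra.
  have h2 : normc (T * (linform p z)^-1 * (linform p z)^-1 *
          (p.1%:~R / linform p (z + h)) * h ^+ 2) <= 16 * rho ^+ 4 * normc h ^+ 2.
    rewrite normcM normcX ler_wpM2r ?exprn_ge0 ?normc_ge0// !normcM.
    apply: (@le_trans _ _ (8 * rho * rho * (2 * rho))).
      by rewrite ler_pM// ?ler_pM// ?ler_pM// ?mulr_ge0 ?normc_ge0.
    have : 0 <= rho ^+ 3 * (rho - 1) by rewrite mulr_ge0 ?exprn_ge0 ?subr_ge0//; lra.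
    lra.
  have : 0 <= rho ^+ 4 * normc h ^+ 2 by rewrite mulr_ge0 ?exprn_ge0 ?normc_ge0//; lra.
  lra.
Qed.

End PoincareHolomorphic.

Section PoincareCuspForm.
Variable R : realType.
Implicit Types (z w h : R[i]) (p q : int * int) (k : nat).

Let taylor_radius_gt0 z : 0 < complex.Im z -> 0 < taylor_radius z.
Proof. by move=> y0; rewrite divr_gt0// exprn_gt0// margin_gt0. Qed.

Let Im_near z h : 0 < complex.Im z -> normc h <= taylor_radius z ->
  0 < complex.Im (z + h).
Proof.
move=> y0 hr; have m0 := margin_gt0 y0; have m1 := margin_le1 y0.
have my : margin z <= complex.Im z.
  rewrite ler_pdivrMr; last by have := normc_ge0 z; lra.
  by have := normc_ge0 z; nra.
have -> : complex.Im (z + h) = complex.Im z + complex.Im h.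
  by case: z {y0 hr m0 m1 my} => a b; case: h.
have := Im_le_normc h; rewrite ler_norml => /andP[h1 _].
have : taylor_radius z < margin z by rewrite /taylor_radius; nra.
lra.
Qed.

(** What [taylorM] and [taylorX] give for the 2k-th power times e(gamma z). *)
Definition poincare_taylor_const k z : R :=
  6 * ((6 * (2 * (margin z)^-1 ^+ 3)) ^+ (2 * k) * (1600 * (margin z)^-1 ^+ 4)).

Let poincare_taylor_const_ge0 k z : 0 < complex.Im z -> 0 <= poincare_taylor_const k z.
Proof.
move=> y0; have m0 := margin_gt0 y0.
have r0 : 0 <= (margin z)^-1 by rewrite invr_ge0 ltW.
have r3 : 0 <= (margin z)^-1 ^+ 3 by exact: exprn_ge0.
have r4 : 0 <= (margin z)^-1 ^+ 4 by exact: exprn_ge0.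
rewrite /poincare_taylor_const; apply: mulr_ge0; first exact: ler0n.
by apply: mulr_ge0; [apply: exprn_ge0; lra|lra].
Qed.

Lemma taylor_poincare_term k z p : (2 <= k)%N -> 0 < complex.Im z ->
  taylor (taylor_radius z) (poincare_taylor_const k z * lattice_weight R p) z
    (fun w => poincare_term k w p).
Proof.
move=> k2 y0; have m0 := margin_gt0 y0; have m1 := margin_le1 y0.
have C0 := poincare_taylor_const_ge0 k y0.
have [cp|cp] := boolP (coprimez p.1 p.2); last first.
  under eq_fun do rewrite poincare_term_0//.
  have CW : 0 <= poincare_taylor_const k z * lattice_weight R p.
    by rewrite mulr_ge0// lattice_weight_ge0.
  exists 0; split; rewrite ?normc0// => h _.
  by rewrite mulr0 !subr0 normc0 mulr_ge0// exprn_ge0// normc_ge0.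
have p0 := coprime_neq0 cp.
have H1 := height_ge1 R p0.
have r1 : taylor_radius z <= 1 by rewrite /taylor_radius; nra.
have := taylorM r1 (taylorX (2 * k) r1 (taylor_height_div_linform y0 p0))
  (taylor_qexp_ratio y0 (pdet_cofactor_row cp)).
rewrite -/(poincare_taylor_const k z) => -[D [fD DD hD]].
have Hk : 0 < height R p ^- (2 * k) by rewrite invr_gt0 exprn_gt0//; lra.
have wk := height_weight R k2 p0.
have nH : normc (height R p ^- (2 * k))%:C = height R p ^- (2 * k).
  by rewrite normcR gtr0_norm.
have termE w : poincare_term k w p = (height R p ^- (2 * k))%:C *
    (((height R p)%:C / linform p w) ^+ (2 * k) *
     qexp (linform (cofactor_row p) w / linform p w)).
  have Hc0 : (height R p)%:C != 0 by rewrite -normc_eq0 normcR normr_eq0; apply: lt0r_neq0; lra.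
  have -> : (height R p ^- (2 * k))%:C = (height R p)%:C ^- (2 * k).
    by rewrite fmorphV rmorphXn.
  by rewrite /poincare_term cp expr_div_n -[in RHS]mulrA mulKf ?expf_neq0// mulrC.
exists ((height R p ^- (2 * k))%:C * D); split.
- rewrite termE normcM nH [leRHS]mulrC ler_pM ?normc_ge0// ltW//.
- by rewrite normcM nH [leRHS]mulrC ler_pM ?normc_ge0// ltW.
- move=> h hr; rewrite !termE (mulrCA h) -!mulrBr normcM nH mulrAC [leRHS]mulrC.
  by rewrite ler_pM ?normc_ge0// ?hD// ltW.
Qed.

(** Term by term, with the lattice weights as summable constants. *)
Lemma poincare_holomorphic k : (2 <= k)%N -> holomorphic (@poincare R k).
Proof.
move=> k2 z y0; have r0 := taylor_radius_gt0 y0.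
apply: (taylor_derivable r0); apply: (@taylor_has_sum _ _ (@poincare_term R k)
  _ _ _ (poincare_taylor_const k z) 256 (lattice_weight R)).
- exact: ltW.
- exact: (poincare_taylor_const_ge0 k y0).
- by move=> p; exact: taylor_poincare_term.
- by move=> B; exact: sum_lattice_weight.
- by move=> h hr; apply: poincare_has_sum => //; apply: Im_near.
Qed.

(** 5^4 from |cz+d| >= (|c| + |d|)/5, and 256 the total lattice weight. *)
Definition remainder_const : R := 5 ^+ 4 * 256.

Lemma remainder_const_ge1 : 1 <= remainder_const.
Proof. by rewrite /remainder_const; lra. Qed.

Let inv_exp_split (y l H W : R) n : 0 < y -> y <= l -> 0 < H -> H / 5 <= l ->
  H ^- 4 <= W -> l ^- (n + 4) <= 5 ^+ 4 * y ^- n * W.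
Proof.
move=> y0 yl H0 Hl HW; have l0 : 0 < l by lra.
have h1 : l ^- n <= y ^- n.
  by rewrite lef_pV2 ?posrE ?exprn_gt0// lerXn2r ?nnegrE ?(ltW l0) ?(ltW y0).
have h2 : l ^- 4 <= (H / 5) ^- 4.
  have h5 : 0 < H / 5 by lra.
  rewrite lef_pV2 ?posrE ?(exprn_gt0 _ h5) ?(exprn_gt0 _ l0)//.
  by rewrite lerXn2r ?nnegrE ?(ltW l0) ?(ltW h5).
have hE : (H / 5) ^- 4 = 5 ^+ 4 * H ^- 4 by field; lra.
rewrite exprD invfM [5 ^+ 4 * _]mulrC -mulrA; apply: ler_pM h1 _.
- by rewrite invr_ge0 exprn_ge0// ltW.
- by rewrite invr_ge0 exprn_ge0// ltW.
- by apply: (le_trans h2); rewrite hE; apply: ler_wpM2l HW; rewrite exprn_ge0.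
Qed.

(** The terms with c = 0 are those of (0,1) and (0,-1), each equal to e(z). In
    the others, four of the 2k factors 1/|cz+d| are spent on the convergence of
    the sum and the remaining ones are at most 1/y, because |cz+d| >= |c|y. *)
Lemma poincare_leading k z : (2 <= k)%N -> `|complex.Re z| <= 2^-1 ->
  2^-1 <= complex.Im z ->
  normc (poincare k z - 2 * qexp z) <= remainder_const * complex.Im z ^- (2 * k - 4).
Proof.
move=> k2.
have [n nE] : exists n, (2 * k = n + 4)%N by exists (2 * k - 4)%N; lia.
move=> x2 y2; have y0 : 0 < complex.Im z by lra.
(* Here |z| <= 1/2 + y and y >= 1/2. *)
have m5 : 5^-1 <= margin z.
  have := normc_le_ReIm z; rewrite (gtr0_norm y0) => nz.
  rewrite ler_pdivlMr; last by have := normc_ge0 z; lra.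
  lra.
pose main p : R[i] := if p.1 == 0 then poincare_term k z p else 0.
have hmain : has_sum main (2 * qexp z).
  have -> : 2 * qexp z = \sum_(p <- [fset (0%:Z, 1%:Z); (0%:Z, -1%:Z)]%fset) main p.
    rewrite big_fsetU1/=; last by rewrite inE.
    rewrite big_seq_fset1 /main/=.
    rewrite (@poincare_termE _ k z (1, 0) (0, 1))//.
    rewrite (@poincare_termE _ k z (-1, 0) (0, -1))//.
    rewrite /linform/= mul1r mul0r addr0 add0r divr1 expr1n divr1.
    rewrite !rmorphN/= !(mulN1r, mul0r, addr0, add0r) invrN invr1 mulrNN mulr1.
    by rewrite exprM sqrrN !expr1n divr1 mulr2n mulrDl mul1r.
  apply: has_sum_finsupp => -[c d]; rewrite !inE/= /main/= => cd.
  case: eqP => // c0; rewrite poincare_term_0//= c0.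
  rewrite /coprimez gcd0z; apply: contra cd; rewrite c0 !xpair_eqE/=.
  by case: d => -[|[|d]].
apply: (normc_has_sum_le (has_sumB (poincare_has_sum k2 y0) hmain)) => B.
have Y0 : 0 <= complex.Im z ^- (2 * k - 4) by rewrite invr_ge0 exprn_ge0// ltW.
apply: (@le_trans _ _ (\sum_(p <- B) (5 ^+ 4 * complex.Im z ^- (2 * k - 4)) * lattice_weight R p)); last first.
  rewrite -mulr_sumr.
  have := @sum_lattice_weight R B; move: (complex.Im z ^- _) Y0 => t t0 hB.
  have : 5 ^+ 4 * t * (\sum_(p <- B) lattice_weight R p) <= 5 ^+ 4 * t * 256.
    by apply: ler_wpM2l hB; apply: mulr_ge0 t0; rewrite exprn_ge0.
  rewrite /remainder_const; lra.
apply: ler_sum => p _; rewrite /main.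
have W0 : 0 <= 5 ^+ 4 * complex.Im z ^- (2 * k - 4) * lattice_weight R p.
  move: (lattice_weight_ge0 R p) Y0; move: (lattice_weight R p) (complex.Im z ^- _).
  by move=> W t W0 t0; apply: mulr_ge0 W0; apply: mulr_ge0 t0; rewrite exprn_ge0.
case: eqP => c0; first by rewrite subrr normc0.
rewrite subr0; have [cp|cp] := boolP (coprimez p.1 p.2); last first.
  by rewrite poincare_term_0// normc0.
have p0 := coprime_neq0 cp.
have H1 := height_ge1 R p0.
have l0 : 0 < normc (linform p z) by rewrite normc_gt0 linform_neq0.
have ly : complex.Im z <= normc (linform p z).
  apply: le_trans (Im_le_normc _); rewrite Im_linform normrM (gtr0_norm y0).
  rewrite ler_peMl ?normr_int_absz ?(ltW y0)// (ler_nat _ 1) absz_gt0.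
  exact/eqP.
have lH : height R p / 5 <= normc (linform p z).
  by apply: le_trans (linform_lower p y0); rewrite mulrC ler_wpM2r//; lra.
apply: le_trans (normc_poincare_term k y0 cp) _.
rewrite nE addnK.
exact: inv_exp_split y0 ly (lt_le_trans ltr01 H1) lH (lattice_weight_lower R p0).
Qed.

Definition translation (n : int) : 'M[int]_2 :=
  \matrix_(i, j) (if i == j then 1 else if (i : nat) == 0%N then n else 0).

Lemma poincare_translate k z (n : int) : (2 <= k)%N -> 0 < complex.Im z ->
  poincare k (z + n%:~R) = poincare k z.
Proof.
move=> k2 y0; have d1 : \det (translation n) = 1.
  by rewrite det_22 !mxE/= mulr0 subr0.
have := poincare_modular k2 d1 y0.
rewrite /moebius /denom !mxE/= mul0r add0r mul1r divr1 expr1n mul1r.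
by [].
Qed.

(** By translation one may assume |Re z| <= 1/2, where [poincare_leading]
    bounds the series by a multiple of 1/y. *)
Lemma poincare_vanishes_at_cusp k : (3 <= k)%N -> vanishes_at_cusp (@poincare R k).
Proof.
move=> k3 e e0; have k2 : (2 <= k)%N by exact: ltnW.
exists (Num.max 1 ((remainder_const + 2) / e)) => z y0 Yz.
have [y1 ye] : 1 < complex.Im z /\ (remainder_const + 2) / e < complex.Im z.
  by move: Yz; rewrite gt_max => /andP.
pose n := Num.floor (complex.Re z + 2^-1).
rewrite normE ltcR -(poincare_translate (- n) k2 y0).
set w := z + _.
have ReIm : complex.Re w = complex.Re z - n%:~R /\ complex.Im w = complex.Im z.
  rewrite /w rmorphN/= -(rmorph_int (real_complex R)).
  by case: (z) => a b /=; rewrite oppr0 addr0.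
have [Rew Imw] := ReIm.
have x2 : `|complex.Re w| <= 2^-1.
  have := floor_le_tmp (complex.Re z + 2^-1).
  have := floorD1_gt (complex.Re z + 2^-1).
  rewrite -/n intrD Rew ler_norml; lra.
have y2 : 2^-1 <= complex.Im w by rewrite Imw; lra.
have := poincare_leading k2 x2 y2; rewrite Imw => lead.
have t1 : complex.Im z ^- (2 * k - 4) <= (complex.Im z)^-1.
  rewrite lef_pV2 ?posrE ?exprn_gt0//.
  by apply: ler_eXnr; [lia|exact: ltW].
have t2 : remainder_const * complex.Im z ^- (2 * k - 4) <= remainder_const * (complex.Im z)^-1.
  by rewrite ler_wpM2l// (le_trans _ remainder_const_ge1).
have q1 : normc (2 * qexp w) <= 2 * (complex.Im z)^-1.
  rewrite normcM normc_qexp Imw.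
  have -> : normc (2 : R[i]) = 2 by have := normc_int R 2.
  rewrite ler_wpM2l// expRN lef_pV2 ?posrE ?expR_gt0//.
  have := expR_ge1Dx (pi *+ 2 * complex.Im z); have := @pi_ge2 R; nra.
have := ler_normcD (poincare k w - 2 * qexp w) (2 * qexp w); rewrite subrK.
have : (remainder_const + 2) * (complex.Im z)^-1 < e.
  by move: ye; rewrite !ltr_pdivrMr// [ltRHS]mulrC.
lra.
Qed.

Lemma poincare_cusp_form k : (3 <= k)%N -> cusp_form k (@poincare R k).
Proof.
move=> k3; have k2 : (2 <= k)%N by exact: ltnW.
split; [exact: poincare_holomorphic|exact: poincare_modular|].
exact: poincare_vanishes_at_cusp.
Qed.

End PoincareCuspForm.

(** * Measurability on the half-plane *)

Section PlaneMeasurability.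
Variable R : realType.
Implicit Types (p q : R * R).

(** Such a set is a countable union of boxes with rational corners. *)
Lemma measurable_open_boxes (W : set (R * R)) :
  (forall p, W p -> exists2 d : R, 0 < d &
    forall q, `|q.1 - p.1| < d -> `|q.2 - p.2| < d -> W q) ->
  measurable W.
Proof.
move=> Wopen.
pose box (i : (rat * rat) * (rat * rat)) : set (R * R) :=
  `](ratr i.1.1), (ratr i.1.2)[%classic `*` `](ratr i.2.1), (ratr i.2.2)[%classic.
have -> : W = \bigcup_i (if `[< box i `<=` W >] then box i else set0).
  apply/seteqP; split => p; last by case=> i _; case: asboolP => // /(_ p).
  move=> /Wopen[d d0 dW].
  have rat_pair (x : R) : exists a b : rat,
      x - d < ratr a < x /\ x < ratr b < x + d.
    have [a] : exists a : rat, ratr a \in `]x - d, x[ by apply: rat_in_itvoo; rewrite gtrBl.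
    have [b] : exists b : rat, ratr b \in `]x, x + d[ by apply: rat_in_itvoo; rewrite ltrDl.
    by rewrite !in_itv/= => ? ?; exists a, b.
  have [a1 [b1 [/andP[l1 l2] /andP[l3 l4]]]] := rat_pair p.1.
  have [a2 [b2 [/andP[l5 l6] /andP[l7 l8]]]] := rat_pair p.2.
  exists ((a1, b1), (a2, b2)) => //; case: asboolP => [_|].
    by split; rewrite /= in_itv/=; apply/andP.
  case=> q [/=]; rewrite !in_itv/= => /andP[? ?] /andP[? ?].
  by apply: dW; rewrite ltr_norml; apply/andP; split; lra.
apply: countable_bigcupT_measurable => //= i.
by case: ifP => // _; apply: measurableX; exact: measurable_itv.
Qed.

Definition upper_half_coords : set (R * R) := [set p | 0 < p.2].

Lemma measurable_upper_half_coords : measurable upper_half_coords.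
Proof.
apply: measurable_open_boxes => p p0; exists p.2 => // q _.
by rewrite ltr_norml /upper_half_coords/=; lra.
Qed.

Lemma measurable_continuous_upper (phi : R * R -> R) :
  (forall p, 0 < p.2 -> forall e : R, 0 < e -> exists2 d : R, 0 < d &
    forall q, `|q.1 - p.1| < d -> `|q.2 - p.2| < d -> `|phi q - phi p| < e) ->
  measurable_fun upper_half_coords phi.
Proof.
move=> cphi; apply: (measurability _ (RGenOInfty.measurableE R)).
move=> _ [_ [a ->] <-]; apply: measurable_open_boxes => p [/= p0].
rewrite in_itv/= andbT => ap.
have ap0 : 0 < phi p - a by rewrite subr_gt0.
have [d d0 hd] := cphi p p0 _ ap0.
have dp0 : 0 < Num.min d p.2 by rewrite lt_min d0.
exists (Num.min d p.2) => // q; rewrite !lt_min => /andP[h1 _] /andP[h2 h3].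
split; first by move: h3; rewrite ltr_norml /upper_half_coords/=; lra.
have := hd q h1 h2; rewrite /= in_itv/= andbT ltr_norml; lra.
Qed.

Lemma measurable_fundamental_domain : measurable (@fundamental_domain R).
Proof.
have -> : @fundamental_domain R = upper_half_coords `\`
   ([set p | 2^-1 < `|p.1|] `|` [set p | p.1 ^+ 2 + p.2 ^+ 2 < 1]).
  apply/seteqP; split => p /=.
    by case=> h1 h2 h3; split => // -[]/=; rewrite ltNge ?h2 ?h3.
  case=> h1 h2; split => //; rewrite leNgt; apply/negP => h; apply: h2; by [left|right].
apply: measurableD; first exact: measurable_upper_half_coords.
apply: measurableU.
  have mf : measurable_fun [set: R * R] (fun p => `|p.1|).
    by apply: measurableT_comp => //; exact: measurable_fst.
  rewrite [X in measurable X](_ : _ = setT `&` (fun p => `|p.1|) @^-1` `]2^-1, +oo[).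
    by apply: mf => //; exact: measurable_itv.
  by apply/seteqP; split => p /=; rewrite in_itv/= andbT// => -[].
have mf : measurable_fun [set: R * R] (fun p => p.1 ^+ 2 + p.2 ^+ 2).
  by apply: measurable_funD; apply: measurable_funX;
    [exact: measurable_fst|exact: measurable_snd].
rewrite [X in measurable X](_ : _ = setT `&` (fun p => p.1 ^+ 2 + p.2 ^+ 2) @^-1` `]-oo, 1[).
  by apply: mf => //; exact: measurable_itv.
by apply/seteqP; split => p /=; rewrite in_itv/=// => -[].
Qed.

Lemma fundamental_domain_upper : @fundamental_domain R `<=` upper_half_coords.
Proof. by move=> p []. Qed.

End PlaneMeasurability.

(** * Integrability of products of cusp forms and Parseval *)

Section Petersson.
Variable R : realType.
Implicit Types (f g : R[i] -> R[i]) (k : nat) (p : R * R).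

Local Notation mu := ((@lebesgue_measure R \x @lebesgue_measure R)%E).
Local Notation F := (@fundamental_domain R).

Let hz p : R[i] := p.1 +i* p.2.

(** The same sets are measurable for the product of the generated
    sigma-algebras that carry the Lebesgue measures. *)
Let measurable_F :
  measurable (F : set (measurableTypeR R * measurableTypeR R)).
Proof. exact: measurable_fundamental_domain. Qed.

Lemma measurable_holomorphic_ReIm f : holomorphic f ->
  measurable_fun F (fun p => complex.Re (f (hz p))) /\
  measurable_fun F (fun p => complex.Im (f (hz p))).
Proof.
move=> hf.
have cont (proj : R[i] -> R) : (forall z w, proj (z - w) = proj z - proj w) ->
    (forall z, `|proj z| <= normc z) ->
    measurable_fun F (fun p => proj (f (hz p))).
  move=> projB proj_le.
  apply: (measurable_funS (@measurable_upper_half_coords R)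
    (@fundamental_domain_upper R)).
  apply: measurable_continuous_upper => p p0 e e0.
  have [d d0 hd] := derivable_continuous_eps (hf (hz p) p0) e0.
  have d20 : 0 < d / 2 by rewrite divr_gt0.
  exists (d / 2) => // q h1 h2; rewrite -projB; apply: le_lt_trans (proj_le _) _.
  apply: hd; apply: le_lt_trans (normc_le_ReIm _) _.
  by rewrite /hz/=; lra.
by split; apply: cont => [[a b] [c d]//|z]; [exact: Re_le_normc|exact: Im_le_normc].
Qed.

Definition cusp_weight k p : R := p.2 ^+ (2 * k) / p.2 ^+ 2.

Lemma cusp_weightE k p : (0 < k)%N -> 0 < p.2 -> cusp_weight k p = p.2 ^+ (2 * k - 2).
Proof.
move=> k0 p0; rewrite /cusp_weight.
have [n ->] : exists n, (2 * k = n + 2)%N by exists (2 * k - 2)%N; lia.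
by rewrite (exprD _ n 2) addnK mulfK// expf_neq0// gt_eqF.
Qed.

Lemma cusp_weight_ge0 k p : 0 < p.2 -> 0 <= cusp_weight k p.
Proof. by move=> p0; rewrite divr_ge0// exprn_ge0// ltW. Qed.

Lemma measurable_cusp_weight k : (0 < k)%N -> measurable_fun F (cusp_weight k).
Proof.
move=> k0; apply: (eq_measurable_fun (fun p => p.2 ^+ (2 * k - 2))).
  by move=> p /set_mem[p0 _ _]; rewrite cusp_weightE.
by apply: measurable_funX; apply: measurable_funTS; exact: measurable_snd.
Qed.

(** The real integrands whose integrals are the two parts of the Petersson
    product. *)
Definition re_part k f g p : R := complex.Re (f (hz p) * (g (hz p))^*
  * (complex.Im (hz p) ^+ (2 * k))%:C) / p.2 ^+ 2.
Definition im_part k f g p : R := complex.Im (f (hz p) * (g (hz p))^*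
  * (complex.Im (hz p) ^+ (2 * k))%:C) / p.2 ^+ 2.

Lemma re_partE k f g p : re_part k f g p =
  (complex.Re (f (hz p)) * complex.Re (g (hz p)) +
   complex.Im (f (hz p)) * complex.Im (g (hz p))) * cusp_weight k p.
Proof.
by rewrite /re_part /cusp_weight /hz/=; case: (f _) (g _) => [a b] [c d]/=; ring.
Qed.

Lemma im_partE k f g p : im_part k f g p =
  (complex.Im (f (hz p)) * complex.Re (g (hz p)) -
   complex.Re (f (hz p)) * complex.Im (g (hz p))) * cusp_weight k p.
Proof.
by rewrite /im_part /cusp_weight /hz/=; case: (f _) (g _) => [a b] [c d]/=; ring.
Qed.

Lemma re_part_diag k f p : re_part k f f p = normc (f (hz p)) ^+ 2 * cusp_weight k p.
Proof. by rewrite re_partE normc_sqr -!expr2. Qed.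

Lemma measurable_parts k f g : (0 < k)%N -> holomorphic f -> holomorphic g ->
  measurable_fun F (re_part k f g) /\ measurable_fun F (im_part k f g).
Proof.
move=> k0 /measurable_holomorphic_ReIm[fu fv] /measurable_holomorphic_ReIm[gu gv].
have mw := measurable_cusp_weight k0.
split.
  rewrite (funext (re_partE k f g)).
  by apply: measurable_funM => //; apply: measurable_funD; apply: measurable_funM.
rewrite (funext (im_partE k f g)).
by apply: measurable_funM => //; apply: measurable_funB; apply: measurable_funM.
Qed.

Lemma peterssonE k f g : petersson k f g =
  (\int[mu]_(p in F) re_part k f g p) +i* (\int[mu]_(p in F) im_part k f g p).
Proof. by []. Qed.

(** The real part of <f,f> is an integral that would be 0 by convention if the
    integral of the nonnegative integrand were infinite; so <f,f> = 1 yields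
    integrability. *)
Lemma integrable_diag k f : (0 < k)%N -> holomorphic f -> petersson k f f = 1 ->
  mu.-integrable F (EFin \o re_part k f f).
Proof.
move=> k0 hf; rewrite peterssonE => -[/= ff1 _].
have [mff _] := measurable_parts k0 hf hf.
apply/integrableP; split; first exact/measurable_EFinP.
have pos p : F p -> 0 <= re_part k f f p.
  case=> p0 _ _; rewrite re_part_diag mulr_ge0 ?exprn_ge0 ?normc_ge0//.
  exact: cusp_weight_ge0.
have -> : (\int[mu]_(p in F) `|(EFin \o re_part k f f) p| =
    \int[mu]_(p in F) (re_part k f f p)%:E)%E.
  by apply: eq_integral => p /set_mem /pos h; rewrite /= ger0_norm.
rewrite ltey; apply/eqP => inf; move: ff1; rewrite /Rintegral inf/=.
by move=> /esym/eqP; rewrite oner_eq0.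
Qed.

Let abs_scalar_product_le (a b c d w : R) : 0 <= w ->
  `|(a * c + b * d) * w| <= `|(a ^+ 2 + b ^+ 2) * w + (c ^+ 2 + d ^+ 2) * w|.
Proof.
move=> w0; rewrite -mulrDl !normrM (ger0_norm w0) ler_wpM2r//.
have := sqr_ge0 (a + c); have := sqr_ge0 (b + d).
have := sqr_ge0 (a - c); have := sqr_ge0 (b - d).
have := sqr_ge0 a; have := sqr_ge0 b; have := sqr_ge0 c; have := sqr_ge0 d.
move=> ? ? ? ? ? ? ? ?; rewrite [leRHS]ger0_norm; last lra.
by rewrite ler_norml; apply/andP; split; lra.
Qed.

Let abs_cross_product_le (a b c d w : R) : 0 <= w ->
  `|(b * c - a * d) * w| <= `|(a ^+ 2 + b ^+ 2) * w + (c ^+ 2 + d ^+ 2) * w|.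
Proof.
move=> w0; have := abs_scalar_product_le a b (- d) c w0.
by rewrite sqrrN mulrN [- _ + _]addrC [d ^+ 2 + _]addrC.
Qed.

(** By domination: |f g| <= |f|^2 + |g|^2. *)
Lemma integrable_parts k f g : (0 < k)%N -> holomorphic f -> holomorphic g ->
  petersson k f f = 1 -> petersson k g g = 1 ->
  mu.-integrable F (EFin \o re_part k f g) /\
  mu.-integrable F (EFin \o im_part k f g).
Proof.
move=> k0 hf hg ff1 gg1; have [mr mi] := measurable_parts k0 hf hg.
have mF := measurable_F.
have dom := integrableD mF (integrable_diag k0 hf ff1) (integrable_diag k0 hg gg1).
split; apply: (le_integrable mF _ _ dom) => //; try exact/measurable_EFinP.
all: move=> p [p0 _ _]; rewrite /= lee_fin !re_part_diag ?re_partE ?im_partE.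
all: rewrite !normc_sqr.
- exact: abs_scalar_product_le (cusp_weight_ge0 k p0).
- exact: abs_cross_product_le (cusp_weight_ge0 k p0).
Qed.

Let Rintegral_sum (I : Type) (s : seq I) (h : I -> R * R -> R) :
  (forall i, mu.-integrable F (EFin \o h i)) ->
  mu.-integrable F (EFin \o (fun p => \sum_(i <- s) h i p)) /\
  \int[mu]_(p in F) (\sum_(i <- s) h i p) = \sum_(i <- s) \int[mu]_(p in F) h i p.
Proof.
have mF := measurable_F; move=> hi; elim: s => [|i s [IH1 IH2]].
  split; last by under eq_Rintegral do rewrite big_nil; rewrite Rintegral_cst// mul0r big_nil.
  under eq_fun do rewrite big_nil; exact: integrable0.
have -> : (fun p => \sum_(j <- i :: s) h j p) = (fun p => h i p + \sum_(j <- s) h j p).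
  by apply/funext => p; rewrite big_cons.
split; last by rewrite RintegralD// IH2 big_cons.
exact: (integrableD mF (hi i) IH1).
Qed.

(** The square |g|^2 expands into a double sum over the basis, and
    orthonormality leaves the diagonal. *)
Theorem parseval k d (f : 'I_d -> R[i] -> R[i]) g (a : 'I_d -> R[i]) : (0 < k)%N ->
  (forall j, holomorphic (f j)) ->
  (forall i j, petersson k (f i) (f j) = (i == j)%:R) ->
  (forall z, upper_half_plane z -> g z = \sum_(j < d) a j * f j z) ->
  mu.-integrable F (EFin \o re_part k g g) /\
  \int[mu]_(p in F) re_part k g g p = \sum_(j < d) normc (a j) ^+ 2.
Proof.
move=> k0 hf on gE; have mF := measurable_F.
have ff1 j : petersson k (f j) (f j) = 1 by rewrite on eqxx.
pose c i j := a i * (a j)^*.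
pose h i j p := complex.Re (c i j) * re_part k (f i) (f j) p
  - complex.Im (c i j) * im_part k (f i) (f j) p.
have ih i j : mu.-integrable F (EFin \o h i j).
  have [ir ii] := integrable_parts k0 (hf i) (hf j) (ff1 i) (ff1 j).
  exact: (integrableB mF (integrableZl mF (complex.Re (c i j)) ir)
    (integrableZl mF (complex.Im (c i j)) ii)).
have inth i j : \int[mu]_(p in F) h i j p = (i == j)%:R * normc (a i) ^+ 2.
  have [ir ii] := integrable_parts k0 (hf i) (hf j) (ff1 i) (ff1 j).
  rewrite RintegralB//; last 2 first.
  - exact: (integrableZl mF (complex.Re (c i j)) ir).
  - exact: (integrableZl mF (complex.Im (c i j)) ii).
  rewrite !RintegralZl//.
  have := on i j; rewrite peterssonE => /eqP; rewrite eq_complex => /andP[/eqP + /eqP].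
  move=> /= -> ->; case: eqVneq => [->|_] /=; last by rewrite !mulr0 mul0r subrr.
  rewrite mulr0 subr0 mulr1 mul1r normc_sqr /c; case: (a j) => x y /=; ring.
have gh p : F p -> re_part k g g p = \sum_(i < d) \sum_(j < d) h i j p.
  case=> p0 _ _; have gp : g (hz p) = \sum_(j < d) a j * f j (hz p) by exact: gE.
  set N := (complex.Im (hz p) ^+ (2 * k))%:C.
  have -> : re_part k g g p = complex.Re (\sum_(i < d) \sum_(j < d)
      c i j * (f i (hz p) * (f j (hz p))^* * N)) / p.2 ^+ 2.
    rewrite /re_part -/N gp rmorph_sum/= mulr_suml mulr_suml.
    congr (complex.Re _ / _); apply: eq_bigr => i _.
    rewrite mulr_sumr mulr_suml; apply: eq_bigr => j _.
    by rewrite rmorphM/= /c; ring.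
  have Re_sum (u : 'I_d -> R[i]) : complex.Re (\sum_i u i) = \sum_i complex.Re (u i).
    by apply: (big_morph _ _ erefl) => -[? ?] [].
  rewrite Re_sum mulr_suml; apply: eq_bigr => i _.
  rewrite Re_sum mulr_suml; apply: eq_bigr => j _.
  rewrite /h /re_part /im_part -/N.
  by case: (c i j) (_ * N) => [x y] [u v] /=; ring.
have [ii Hi] := Rintegral_sum (index_enum 'I_d) (fun i =>
  (Rintegral_sum (index_enum 'I_d) (ih i)).1).
split.
  apply: eq_integrable ii => // p /set_mem Fp /=.
  by rewrite gh.
transitivity (\int[mu]_(p in F) (\sum_(i < d) \sum_(j < d) h i j p)).
  by apply: eq_Rintegral => p /set_mem Fp; rewrite gh.
rewrite Hi; apply: eq_bigr => i _.
rewrite (Rintegral_sum (index_enum 'I_d) (ih i)).2.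
rewrite (bigD1 i)//= inth eqxx mul1r big1 ?addr0// => j ji.
by rewrite inth eq_sym (negbTE ji) mul0r.
Qed.

End Petersson.

(** * Two integrals on half-lines *)

Section ExpMoment.
Variable R : realType.
Implicit Types (c y : R) (n : nat).
Local Notation leb := (@lebesgue_measure R).

(** A primitive of y^n exp(-cy) vanishing at infinity, built by iterated
    integration by parts. *)
Fixpoint exp_moment_primitive c n y : R := match n with
  | 0 => - (expR (- (c * y)) / c)
  | n'.+1 => - (y ^+ n * expR (- (c * y)) / c) + n%:R / c * exp_moment_primitive c n' y
  end.

Let is_derive_expM c y : is_derive y 1 (fun x => expR (- (c * x))) (- c * expR (- (c * y))).
Proof.
have h : is_derive y 1 (fun x => - (c * x)) (- c).
  by apply: is_derive_eq; rewrite -[_ *: _]/(_ * _) mulr1.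
have := @is_derive1_comp _ expR (fun x => - (c * x)) y _ _ (is_derive_expR _) h.
by rewrite mulrC.
Qed.

Lemma is_derive_exp_moment_primitive c n y : c != 0 ->
  is_derive y 1 (exp_moment_primitive c n) (y ^+ n * expR (- (c * y))).
Proof.
move=> c0; elim: n => [|n IH].
  have h := is_derive_expM c y.
  rewrite (_ : exp_moment_primitive c 0 = fun x => - (c^-1 * expR (- (c * x)))); last first.
    by apply/funext => x /=; rewrite mulrC.
  apply: is_derive_eq.
  by rewrite expr0 mul1r -[_ *: _]/(_ * _); field.
have h := is_derive_expM c y.
rewrite (_ : exp_moment_primitive c n.+1 = fun x =>
  - (c^-1 * (x ^+ n.+1 * expR (- (c * x)))) + n.+1%:R / c * exp_moment_primitive c n x); last first.
  by apply/funext => x; rewrite [LHS]/=; congr (- _ + _); rewrite mulrC.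
have h1 : is_derive y 1 (fun x : R => x ^+ n.+1) (n.+1%:R * y ^+ n).
  have -> : (fun x : R => x ^+ n.+1) = id ^+ n.+1 by apply/funext => x; rewrite exprfctE.
  apply: (is_derive_eq (is_deriveX n.+1 (is_derive_id y (1 : R)))).
  by rewrite -[_ *: _]/(_ * _) mulr1.
have h3 := is_deriveD (is_deriveN (is_deriveZ c^-1 (is_deriveM h1 h)))
  (is_deriveZ (n.+1%:R / c) IH).
apply: (is_derive_eq h3).
rewrite -![_ *: _]/(_ * _) exprS.
by field.
Qed.

Lemma exp_moment_cvg0 c n : 0 < c ->
  y ^+ n * expR (- (c * y)) @[y --> +oo] --> (0 : R).
Proof.
move=> c0; apply/cvgrPdist_le => e e0; near=> y.
have y0 : 0 < y by near: y; apply: nbhs_pinfty_gt; exact: num_real.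
have yb : n.+1`!%:R / c ^+ n.+1 / e <= y by near: y; apply: nbhs_pinfty_ge; exact: num_real.
have cn0 : 0 < c ^+ n.+1 by rewrite exprn_gt0.
rewrite sub0r normrN ger0_norm ?mulr_ge0 ?exprn_ge0 ?expR_ge0 ?(ltW y0)//.
rewrite expRN ler_pdivrMr ?expR_gt0//.
have f0 : 0 < n.+1`!%:R :> R by rewrite ltr0n fact_gt0.
have : (c * y) ^+ n.+1 / n.+1`!%:R <= expR (c * y).
  have cy0 : 0 <= c * y by rewrite mulr_ge0// ltW.
  by have := expR_ge1Dxn n cy0; lra.
move=> h; apply: (@le_trans _ _ (e * ((c * y) ^+ n.+1 / n.+1`!%:R))); last first.
  by rewrite ler_pM2l.
move: yb; rewrite !ler_pdivrMr// exprMn (exprSr y) => yb.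
have -> : e * (c ^+ n.+1 * (y ^+ n * y) / n.+1`!%:R) =
  y ^+ n * (y * e * c ^+ n.+1 / n.+1`!%:R) by ring.
by rewrite ler_peMr ?exprn_ge0 ?(ltW y0)// ler_pdivlMr// mul1r.
Unshelve. all: by end_near. Qed.

Lemma exp_moment_primitive_cvg0 c n : 0 < c ->
  exp_moment_primitive c n y @[y --> +oo] --> (0 : R).
Proof.
move=> c0; elim: n => [|n IH].
  rewrite (_ : exp_moment_primitive c 0 = fun y => - c^-1 * (y ^+ 0 * expR (- (c * y)))).
    by rewrite -[X in _ --> X](mulr0 (- c^-1)); apply: cvgMr; exact: exp_moment_cvg0.
  by apply/funext => y /=; rewrite expr0 mul1r mulNr mulrC.
rewrite (_ : exp_moment_primitive c n.+1 = fun y =>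
  - c^-1 * (y ^+ n.+1 * expR (- (c * y))) + n.+1%:R / c * exp_moment_primitive c n y).
  have -> : 0 = - c^-1 * 0 + n.+1%:R / c * 0 :> R by rewrite !mulr0 addr0.
  by apply: cvgD; apply: cvgMr => //; exact: exp_moment_cvg0.
by apply/funext => y; rewrite [LHS]/=; congr (_ + _); rewrite mulNr mulrC.
Qed.

Lemma exp_moment_primitive0 c n :
  c != 0 -> exp_moment_primitive c n 0 = - (n`!%:R / c ^+ n.+1).
Proof.
move=> c0; elim: n => [|n IH] /=.
  by rewrite mulr0 oppr0 expR0 expr1.
rewrite IH expr0n/= !mul0r oppr0 add0r factS natrM !exprS; field.
by rewrite expf_neq0 c0.
Qed.

Lemma exp_moment_continuous c n : continuous (fun y : R => y ^+ n * expR (- (c * y))).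
Proof.
move=> y; apply: cvgM; first exact: exprn_continuous.
apply: (@continuous_comp _ _ _ (fun y => - (c * y)) expR); last exact: continuous_expR.
by apply: cvgN; apply: cvgMr; exact: cvg_id.
Qed.

Lemma integral_exp_moment c n : 0 < c ->
  (\int[leb]_(y in `[0%R, +oo[) (y ^+ n * expR (- (c * y)))%R%:E =
   (n`!%:R / c ^+ n.+1)%R%:E)%E.
Proof.
move=> c0; have cn0 : c != 0 by rewrite gt_eqF.
rewrite (@ge0_continuous_FTC2y R _ (exp_moment_primitive c n) 0 0).
- by rewrite exp_moment_primitive0// EFinN oppeK add0e.
- by move=> y y0; rewrite mulr_ge0 ?exprn_ge0 ?expR_ge0.
- exact/continuous_subspaceT/exp_moment_continuous.
- exact: exp_moment_primitive_cvg0.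
- by move=> y _; have [] := is_derive_exp_moment_primitive n y cn0.
- apply: cvg_at_right_filter; apply: differentiable_continuous.
  by apply/derivable1_diffP; have [] := is_derive_exp_moment_primitive n 0 cn0.
- move=> y _; rewrite derive1E.
  by have [_ ->] := is_derive_exp_moment_primitive n y cn0.
Qed.

Lemma integral_inv_sq : (\int[leb]_(y in `[2^-1%R, +oo[) (y ^- 2)%R%:E = 2%R%:E)%E.
Proof.
have dV (y : R) : 2^-1 <= y -> is_derive y 1 (fun x => - x^-1) (y ^- 2).
  move=> y2; have y0 : y != 0 by rewrite gt_eqF//; lra.
  have h := is_deriveN (is_deriveV y0 (is_derive_id y (1 : R))).
  apply: (is_derive_eq h).
  by rewrite -[_ *: _]/(_ * _) mulr1 opprK.
rewrite (@ge0_continuous_FTC2y R _ (fun y => - y^-1) (2^-1) 0).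
- by rewrite invrK EFinN oppeK add0e.
- by move=> y y0; rewrite invr_ge0 sqr_ge0.
- apply: continuous_in_subspaceT => y; rewrite inE/= in_itv/= andbT => y2.
  apply: cvgV; first by rewrite expf_neq0// gt_eqF//; lra.
  exact: exprn_continuous.
- rewrite -oppr0; apply: cvgN; apply/cvgrPdist_le => e e0; near=> y.
  have y0 : 0 < y by near: y; apply: nbhs_pinfty_gt; exact: num_real.
  have ye : e^-1 <= y by near: y; apply: nbhs_pinfty_ge; exact: num_real.
  by rewrite sub0r normrN ger0_norm ?invr_ge0 ?(ltW y0)// -[e]invrK lef_pV2 ?posrE ?invr_gt0.
- by move=> y y2; have [] := dV y (ltW y2).
- have [/derivable1_diffP/differentiable_continuous h _] := dV _ (lexx _).
  exact: cvg_at_right_filter.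
- move=> y; rewrite in_itv/= andbT => y2; rewrite derive1E.
  by have [_ ->] := dV y (ltW y2).
Unshelve. all: by end_near. Qed.

End ExpMoment.

(** * The Petersson norm of the Poincare series *)

Section NormBound.
Variable R : realType.
Local Notation leb := (@lebesgue_measure R).
Local Notation mu := ((@lebesgue_measure R \x @lebesgue_measure R)%E).
Local Notation F := (@fundamental_domain R).

Lemma fundamental_domain_height (p : R * R) : F p -> 3 / 4 <= p.2 ^+ 2 /\ 2^-1 <= p.2.
Proof.
case=> p0 p1 p2.
have : p.1 ^+ 2 <= (2^-1) ^+ 2 by rewrite -real_normK ?num_real// lerXn2r ?nnegrE.
move=> h; have h2 : 3 / 4 <= p.2 ^+ 2 by lra.
by split=> //; nra.
Qed.

(** The fundamental domain lies in the strip |x| <= 1/2, y >= 1/2, of width 1. *)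
Lemma integral_fundamental_domain_le (b : R -> R) :
  measurable_fun (`[2^-1, +oo[%classic : set R) b -> (forall y, 2^-1 <= y -> 0 <= b y) ->
  (\int[mu]_(p in F) (b p.2)%:E <= \int[leb]_(y in `[2^-1%R, +oo[) (b y)%:E)%E.
Proof.
move=> mb b0; pose A : set R := `[(- 2^-1), 2^-1]%classic; pose B : set R := `[2^-1, +oo[%classic.
have mA : measurable A by exact: measurable_itv.
have mB : measurable B by exact: measurable_itv.
pose f (p : R * R) := ((\1_A p.1 : R) * (\1_B p.2 * b p.2))%:E.
have mBb : measurable_fun [set: R] (fun y => \1_B y * b y).
  rewrite (_ : (fun _ => _) = b \_ B); first exact: ((measurable_restrictT b mB).1 mb).
  by apply/funext => y; rewrite patchE indicE; case: ifPn; rewrite ?mul1r ?mul0r.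
have mf : measurable_fun setT (f : (measurableTypeR R * measurableTypeR R) -> \bar R).
  apply/measurable_EFinP; apply: measurable_funM.
    by apply: measurableT_comp; [exact: measurable_indic|exact: measurable_fst].
  by apply: (measurableT_comp mBb); exact: measurable_snd.
have Bb0 y : 0 <= \1_B y * b y.
  rewrite indicE; have [yB|yB] := boolP (y \in B); last by rewrite mul0r.
  by rewrite mul1r b0//; move/set_mem: yB; rewrite /B/= in_itv/= andbT.
have A1 : (leb A = 1)%E.
  rewrite /A lebesgue_measure_itv/= lte_fin ifT; last lra.
  by rewrite -EFinB opprK (_ : 2^-1 + 2^-1 = 1 :> R)//; lra.
have I1 : (\int[leb]_x (\1_A x)%:E = 1)%E by rewrite integral_indic// setIT.
have f0 p : (0 <= f p)%E by rewrite lee_fin mulr_ge0.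
have mF : measurable (F : set (measurableTypeR R * measurableTypeR R)).
  exact: measurable_fundamental_domain.
have -> : (\int[mu]_(p in F) (b p.2)%:E = \int[mu]_(p in F) f p)%E.
  apply: eq_integral => p /set_mem Fp; have [_ p2] := fundamental_domain_height Fp.
  case: Fp => _ p1 _; rewrite /f !indicE.
  rewrite mem_set ?mem_set ?mul1r//; first by rewrite /B/= in_itv/= p2.
  by rewrite /A/= in_itv/= -ler_norml.
apply: (@le_trans _ _ (\int[mu]_p f p)%E).
  by apply: ge0_subset_integral => //.
rewrite fubini_tonelli2// /fubini_G [leRHS]integral_mkcond.
apply: ge0_le_integral => //.
- by move=> y _; apply: integral_ge0.
- by apply: measurable_fun_fubini_tonelli_G.
- by apply/(measurable_restrictT _ _).1 => //; apply/measurable_EFinP.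
move=> y _; rewrite /f/=.
under eq_integral do rewrite EFinM muleC.
rewrite ge0_integralZl//; last 2 first.
- by apply/measurable_EFinP; exact: measurable_indic.
- by rewrite lee_fin.
rewrite I1 mule1.
rewrite patchE indicE; case: ifPn => yB; last by rewrite mul0r.
by rewrite mul1r.
Qed.

End NormBound.

Section PoincareNorm.
Variable R : realType.
Local Notation leb := (@lebesgue_measure R).
Local Notation mu := ((@lebesgue_measure R \x @lebesgue_measure R)%E).
Local Notation F := (@fundamental_domain R).

Local Notation C1 := (remainder_const R).

Let C1_ge0 : 0 <= C1. Proof. exact: le_trans (remainder_const_ge1 R). Qed.

Let tail_power_le (y : R) m : 0 < y -> 3 / 4 <= y ^+ 2 ->
  (y ^- (2 * m + 4)) ^+ 2 * y ^+ (2 * m + 6) <= 2 ^+ (m + 4) * y ^- 2.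
Proof.
move=> y0 y2; have v0 : 0 < y ^+ 2 by rewrite exprn_gt0.
have -> : (2 * m + 4 = 2 * (m + 2))%N by lia.
have -> : (2 * m + 6 = 2 * ((m + 2) + 1))%N by lia.
rewrite !exprM; move: (y ^+ 2) y2 v0 => v v34 v0.
have v1 : v^-1 <= 2 by rewrite -[2]invrK lef_pV2 ?posrE//; lra.
have -> : (v ^- (m + 2)) ^+ 2 * v ^+ (m + 2 + 1) = v^-1 ^+ (m + 1).
  have e : v ^+ (m + 2) = v ^+ (m + 1) * v by rewrite -exprSr; congr (_ ^+ _); lia.
  rewrite [in RHS]exprVn (exprD v (m + 2) 1) expr1 e; move: (expf_neq0 (m + 1) (lt0r_neq0 v0)).
  by move: (v ^+ (m + 1)) => w w0; field; rewrite w0 gt_eqF.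
rewrite exprD expr1 ler_wpM2r ?invr_ge0 ?(ltW v0)//.
apply: (@le_trans _ _ (2 ^+ m)); first by rewrite lerXn2r ?nnegrE ?invr_ge0 ?(ltW v0).
by rewrite ler_weXn2l ?leq_addr// ler1n.
Qed.

(** From |P|^2 <= 2|2e(z)|^2 + 2|P - 2e(z)|^2; on the fundamental domain
    y^2 >= 3/4 > 1/2, so the powers of 1/y left over in the second summand are
    at most 2^k y^(-2). *)
Definition majorant k y : R := 8 * (y ^+ (2 * k - 2) * expR (- (4 * pi * y)))
  + 2 * C1 ^+ 2 * 2 ^+ k * y ^- 2.

Lemma poincare_sqr_le_majorant k p : (4 <= k)%N -> F p ->
  re_part k (@poincare R k) (@poincare R k) p <= majorant k p.2.
Proof.
move=> k4; have [m kE] : exists m, k = (m + 4)%N by exists (k - 4)%N; lia.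
have e2 : (2 * m + 4 = 2 * k - 4)%N by lia.
have e3 : (2 * m + 6 = 2 * k - 2)%N by lia.
have k0 : (0 < k)%N by lia.
move=> Fp; have [y34 y2] := fundamental_domain_height Fp.
have y0 : 0 < p.2 by lra.
rewrite re_part_diag cusp_weightE//.
have lead := @poincare_leading R k (p.1 +i* p.2) (leq_trans (isT : 2 <= 4)%N k4).
have x2 : `|p.1| <= 2^-1 by case: Fp.
have {}lead := lead x2 y2.
move: lead; rewrite [complex.Im _]/= => lead.
have q2 : normc (2 * qexp (p.1 +i* p.2)) = 2 * expR (- (pi *+ 2 * p.2)).
  by rewrite normcM normc_qexp; congr (_ * _); have := normc_int R 2.
have tri := ler_normcD (poincare k (p.1 +i* p.2) - 2 * qexp (p.1 +i* p.2))
  (2 * qexp (p.1 +i* p.2)).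
rewrite subrK q2 in tri.
have e0 := expR_ge0 (- (pi *+ 2 * p.2)).
have eE : expR (- (pi *+ 2 * p.2)) ^+ 2 = expR (- (4 * pi * p.2)).
  by rewrite -expRM_natl; congr expR; ring.
have P0 := normc_ge0 (poincare k (p.1 +i* p.2)).
have t0 : 0 <= p.2 ^- (2 * k - 4) by rewrite invr_ge0 exprn_ge0// ltW.
have w0 : 0 <= p.2 ^+ (2 * k - 2) by rewrite exprn_ge0// ltW.
have tail := tail_power_le m y0 y34.
rewrite -kE e2 e3 in tail.
rewrite /majorant -eE.
move: tri lead tail t0 w0 e0 P0 {eE q2 kE e2 e3}.
move: (normc (poincare _ _)) (normc (_ - _)) (expR _) (p.2 ^- (2 * k - 4)).
move: C1 C1_ge0 => C C0 P D e t PDe DCt.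
move: (p.2 ^+ (2 * k - 2)) (p.2 ^- 2) (2 ^+ k) => w v K twv t0 w0 e0 P0.
have P2 : P ^+ 2 <= 8 * e ^+ 2 + 2 * C ^+ 2 * t ^+ 2.
  have : P ^+ 2 <= (2 * e + C * t) ^+ 2.
    have Ct0 : 0 <= C * t by exact: mulr_ge0.
    by rewrite lerXn2r ?nnegrE//; lra.
  have := sqr_ge0 (2 * e - C * t); lra.
have : P ^+ 2 * w <= (8 * e ^+ 2 + 2 * C ^+ 2 * t ^+ 2) * w by rewrite ler_wpM2r.
have : C ^+ 2 * (t ^+ 2 * w) <= C ^+ 2 * (K * v) by rewrite ler_wpM2l// sqr_ge0.
lra.
Qed.

Let measurable_exp_moment (c : R) n :
  measurable_fun [set: R] (fun y => y ^+ n * expR (- (c * y))).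
Proof. by apply: continuous_measurable_fun; exact: exp_moment_continuous. Qed.

Let measurable_inv_sq :
  measurable_fun (`[2^-1, +oo[%classic : set R) (fun y : R => y ^- 2).
Proof.
apply: subspace_continuous_measurable_fun; first exact: measurable_itv.
apply: continuous_in_subspaceT => y; rewrite inE/= in_itv/= andbT => y2.
by apply: cvgV; [rewrite expf_neq0// gt_eqF//; lra|exact: exprn_continuous].
Qed.

Let measurable_majorant k :
  measurable_fun (`[2^-1, +oo[%classic : set R) (majorant k).
Proof.
have mE : measurable_fun (`[2^-1, +oo[%classic : set R)
    (fun y => y ^+ (2 * k - 2) * expR (- (4 * pi * y))).
  by apply: measurable_funTS; exact: measurable_exp_moment.
have mV := measurable_inv_sq.
by apply: measurable_funD; apply: measurable_funM.
Qed.

Let majorant_ge0 k y : 2^-1 <= y -> 0 <= majorant k y.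
Proof.
move=> y2; have c0 := exprn_ge0 k (ler0n R 2).
have e0 : 0 <= y ^+ (2 * k - 2) * expR (- (4 * pi * y)).
  by rewrite mulr_ge0 ?expR_ge0// exprn_ge0//; lra.
have v0 : 0 <= y ^- 2 by rewrite invr_ge0 sqr_ge0.
rewrite /majorant; move: (sqr_ge0 C1) c0 e0 v0.
move: (C1 ^+ 2) (2 ^+ k) (_ * expR _) (y ^- 2) => a b e v a0 b0 e0 v0.
by rewrite addr_ge0 ?mulr_ge0.
Qed.

Lemma integral_majorant k :
  (\int[leb]_(y in `[2^-1%R, +oo[) (majorant k y)%:E <=
   (8 * ((2 * k - 2)`!%:R / (4 * pi) ^+ (2 * k - 2).+1) + 4 * C1 ^+ 2 * 2 ^+ k)%R%:E)%E.
Proof.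
have pi4 : 0 < 4 * pi :> R by rewrite mulr_gt0// pi_gt0.
have mE := measurable_exp_moment (4 * pi) (2 * k - 2); have mV := measurable_inv_sq.
have E0 y : 2^-1 <= y -> 0 <= y ^+ (2 * k - 2) * expR (- (4 * pi * y)).
  by move=> y2; rewrite mulr_ge0 ?expR_ge0// exprn_ge0//; lra.
rewrite /majorant; have K0 : 0 <= 2 * C1 ^+ 2 * 2 ^+ k.
  by apply: mulr_ge0; [apply: mulr_ge0; [exact: ler0n|exact: sqr_ge0]|rewrite exprn_ge0].
have K2E : 4 * C1 ^+ 2 * 2 ^+ k = 2 * (2 * C1 ^+ 2 * 2 ^+ k) by ring.
move: K2E K0; move: (2 * C1 ^+ 2 * 2 ^+ k) (4 * C1 ^+ 2 * 2 ^+ k) => K K2 K2E K0.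
have mB : measurable (`[2^-1%R, +oo[%classic : set (measurableTypeR R)).
  exact: measurable_itv.
have EB : (\int[leb]_(y in `[2^-1%R, +oo[) (y ^+ (2 * k - 2) * expR (- (4 * pi * y)))%R%:E <=
    ((2 * k - 2)`!%:R / (4 * pi) ^+ (2 * k - 2).+1)%R%:E)%E.
  rewrite -integral_exp_moment//; apply: ge0_subset_integral => //.
  - by apply/measurable_EFinP; exact: measurable_funTS.
  - move=> y /=; rewrite in_itv/= andbT => y0.
    by rewrite lee_fin mulr_ge0 ?expR_ge0// exprn_ge0.
  - by move=> y /=; rewrite !in_itv/= !andbT; lra.
have B2 y : [set` `[2^-1%R, +oo[] y -> 2^-1 <= y by rewrite /= in_itv/= andbT.
rewrite (_ : (\int[leb]_(y in `[2^-1%R, +oo[) _ =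
  8%:E * (\int[leb]_(y in `[2^-1%R, +oo[) (y ^+ (2 * k - 2) * expR (- (4 * pi * y)))%R%:E) +
  K%:E * (\int[leb]_(y in `[2^-1%R, +oo[) (y ^- 2)%R%:E))%E); last first.
  rewrite -!ge0_integralZl//; last 4 first.
  - exact/measurable_EFinP.
  - by move=> y /B2 y2; rewrite lee_fin invr_ge0 sqr_ge0.
  - by apply/measurable_EFinP; exact: measurable_funTS.
  - by move=> y /B2 y2; rewrite lee_fin E0.
  rewrite -ge0_integralD//.
  - by move=> y /B2 y2; rewrite -EFinM lee_fin mulr_ge0// E0.
  - by apply/measurable_EFinP; apply: measurable_funM => //; exact: measurable_funTS.
  - by move=> y /B2 y2; rewrite -EFinM lee_fin mulr_ge0// invr_ge0 sqr_ge0.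
  - by apply/measurable_EFinP; apply: measurable_funM.
rewrite integral_inv_sq K2E [X in (_ <= X)%E]EFinD; apply: leeD; last by rewrite -EFinM mulrC.
by rewrite EFinM lee_wpmul2l.
Qed.

(** Parseval turns the left-hand side into the integral of |P|^2. *)
Lemma poincare_norm_le k d (f : 'I_d -> R[i] -> R[i]) (a : 'I_d -> R[i]) :
  (4 <= k)%N -> (forall j, holomorphic (f j)) ->
  (forall i j, petersson k (f i) (f j) = (i == j)%:R) ->
  (forall z, upper_half_plane z -> poincare k z = \sum_(j < d) a j * f j z) ->
  \sum_(j < d) normc (a j) ^+ 2 <=
   8 * ((2 * k - 2)`!%:R / (4 * pi) ^+ (2 * k - 2).+1) + 4 * C1 ^+ 2 * 2 ^+ k.
Proof.
move=> k4 hf on Pf; have k0 : (0 < k)%N by lia.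
have mF : measurable (F : set (measurableTypeR R * measurableTypeR R)).
  exact: measurable_fundamental_domain.
have [iP PE] := parseval k0 hf on Pf.
have [mP _] := integrableP _ _ _ iP.
rewrite -lee_fin; apply: le_trans (integral_majorant k).
rewrite -PE /Rintegral fineK; last exact: integrable_fin_num.
apply: le_trans (integral_fundamental_domain_le (@measurable_majorant k)
  (@majorant_ge0 k)).
apply: ge0_le_integral => //.
- move=> p [p0 _ _]; rewrite lee_fin re_part_diag mulr_ge0 ?sqr_ge0//.
  exact: cusp_weight_ge0.
- apply/measurable_EFinP.
  have mB : measurable (`[2^-1%R, +oo[%classic : set (measurableTypeR R)).
    exact: measurable_itv.
  apply: (measurable_comp mB _ (@measurable_majorant k)).
    by move=> _ [p /fundamental_domain_height[_ p2] <-]; rewrite /= in_itv/= p2.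
  by apply: measurable_funTS; exact: measurable_snd.
- by move=> p Fp; rewrite lee_fin; exact: poincare_sqr_le_majorant.
Qed.

End PoincareNorm.

(** * An upper bound for the factorial *)

Section Stirling.
Variable R : realType.

(** The difference of the two sides has derivative x (exp x - exp (-x)) >= 0. *)
Lemma one_sub_mul_expR_le (x : R) : 0 <= x -> (1 - x) * expR x <= (1 + x) * expR (- x).
Proof.
move=> x0; rewrite -subr_ge0.
pose g (t : R) := (1 + t) * expR (- t) - (1 - t) * expR t.
pose g' (t : R) := t * (expR t - expR (- t)).
have dg (t : R) : is_derive t 1 g (g' t).
  have h0 : is_derive t 1 (fun s : R => - s) (- 1) by exact: is_deriveNid.
  have h1 := @is_derive1_comp _ expR (fun s : R => - s) t _ _ (is_derive_expR _) h0.
  have h2 := is_deriveM (is_deriveD (is_derive_cst (1 : R) t 1) (is_derive_id t 1)) h1.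
  have h3 := is_deriveM (is_deriveB (is_derive_cst (1 : R) t 1) (is_derive_id t 1))
    (is_derive_expR t).
  apply: (is_derive_eq (is_deriveB h2 h3)).
  rewrite -![_ *: _]/(_ * _) -[(cst 1 + id) t]/(1 + t) -[(cst 1 - id) t]/(1 - t) /g' /=.
  by ring.
have cg : {within `[0, x], continuous g}.
  apply: derivable_within_continuous => t _.
  by have [] := dg t.
have [c] := @MVT_segment R g g' 0 x x0 (fun t _ => dg t) cg.
rewrite in_itv/= => /andP[c0 _].
have -> : g 0 = 0 by rewrite /g oppr0 expR0; ring.
rewrite !subr0 => gx; rewrite -/(g x) gx !mulr_ge0// subr_ge0 ler_expR; lra.
Qed.

(** With x = 1/(2n+1) one has (1+x)/(1-x) = (n+1)/n, so [one_sub_mul_expR_le]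
    gives exp(2x) <= (n+1)/n; raise it to the power 2n+1. *)
Lemma expR1_sqr_le n : (0 < n)%N ->
  expR 1 ^+ 2 * n%:R ^+ (2 * n + 1) <= n.+1%:R ^+ (2 * n + 1) :> R.
Proof.
move=> n0; have N0 : 0 < n%:R :> R by rewrite ltr0n.
pose x : R := (2 * n%:R + 1)^-1.
have D0 : 0 < 2 * n%:R + 1 :> R by lra.
have x0 : 0 <= x by rewrite invr_ge0 ltW.
have h : expR (2 * x) * n%:R <= n.+1%:R.
  have := one_sub_mul_expR_le x0.
  have -> : 1 - x = 2 * n%:R * x by rewrite /x; field; lra.
  have -> : 1 + x = 2 * n.+1%:R * x by rewrite /x -natr1; field; lra.
  have xp : 0 < x by rewrite invr_gt0.
  have ep := expR_gt0 x.
  move=> h; have {}h : n%:R * expR x <= n.+1%:R * expR (- x).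
    by rewrite -(ler_pM2l (mulr_gt0 (ltr0n R 2) xp)); lra.
  rewrite mulr_natl mulr2n expRD mulrC mulrA.
  by rewrite -(ler_pM2r ep) -[leRHS]mulrA -expRD addNr expR0 mulr1 in h.
have -> : expR 1 ^+ 2 = expR (2 * x) ^+ (2 * n + 1) :> R.
  rewrite -!expRM_natl; congr expR; rewrite natrD natrM /x; field; lra.
by rewrite -exprMn lerXn2r ?nnegrE ?mulr_ge0 ?expR_ge0.
Qed.

(** Induction on n; the step is the square root of [expR1_sqr_le]. *)
Lemma fact_stirling_le n : (0 < n)%N ->
  n`!%:R * expR 1 ^+ n <= expR 1 * Num.sqrt n%:R * n%:R ^+ n :> R.
Proof.
case: n => // n _; elim: n => [|n IH].
  by rewrite factS fact0 muln1 sqrtr1 !expr1 mul1r !mulr1.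
set m := n.+1 in IH *; have m0 : (0 < m)%N by [].
have M0 : 0 < m%:R :> R by rewrite ltr0n.
have e0 := expR_gt0 (1 : R).
have step : expR 1 * Num.sqrt m%:R * m%:R ^+ m <= Num.sqrt m.+1%:R * m.+1%:R ^+ m :> R.
  rewrite -ler_sqr ?nnegrE ?mulr_ge0 ?sqrtr_ge0 ?exprn_ge0 ?(ltW e0)//.
  rewrite !exprMn !sqr_sqrtr//.
  have := expR1_sqr_le m0; rewrite -!exprM [(m * 2)%N]mulnC addn1 !exprS; lra.
rewrite factS natrM exprS.
have -> : m.+1%:R * m`!%:R * (expR 1 * expR 1 ^+ m) =
  m.+1%:R * expR 1 * (m`!%:R * expR 1 ^+ m) :> R by ring.
apply: (@le_trans _ _ (m.+1%:R * expR 1 * (Num.sqrt m.+1%:R * m.+1%:R ^+ m))).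
  rewrite ler_wpM2l ?mulr_ge0 ?(ltW e0)//; exact: le_trans IH step.
by rewrite exprS le_eqVlt; apply/orP; left; apply/eqP; ring.
Qed.

End Stirling.

(** * The lower bound at height k/(2 pi) *)

Section Final.
Variable R : realType.

Lemma cauchy_schwarz_sum d (x y : 'I_d -> R) :
  (\sum_i x i * y i) ^+ 2 <= (\sum_i x i ^+ 2) * (\sum_i y i ^+ 2).
Proof.
set X := \sum_i x i ^+ 2; set Y := \sum_i y i ^+ 2; set Z := \sum_i x i * y i.
have X0 : 0 <= X by apply: sumr_ge0 => i _; exact: sqr_ge0.
have quad (t : R) : 0 <= t ^+ 2 * X - 2 * t * Z + Y.
  have -> : t ^+ 2 * X - 2 * t * Z + Y = \sum_i (t * x i - y i) ^+ 2.
    rewrite /X /Y /Z !mulr_sumr -sumrN -!big_split/=.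
    by apply: eq_bigr => i _; ring.
  by apply: sumr_ge0 => i _; exact: sqr_ge0.
have [X1|X1] := eqVneq X 0; last first.
  have Xp : 0 < X by rewrite lt_def X1.
  have := quad (Z / X); rewrite -(pmulr_rge0 _ Xp).
  have -> : X * ((Z / X) ^+ 2 * X - 2 * (Z / X) * Z + Y) = X * Y - Z ^+ 2 by field.
  by rewrite subr_ge0.
suff -> : Z = 0 by rewrite X1 mul0r expr0n.
rewrite /Z big1// => i _.
have /eqP := X1; rewrite /X psumr_eq0; last by move=> j _; exact: sqr_ge0.
by move=> /allP/(_ i (mem_index_enum _)); rewrite sqrf_eq0 => /eqP ->; rewrite mul0r.
Qed.

(** Cauchy-Schwarz in the coordinates a: the extremal property of the
    reproducing kernel on the diagonal. *)
Lemma S_Gamma_extremal k d (f : 'I_d -> R[i] -> R[i]) (a : 'I_d -> R[i]) g z :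
  0 < complex.Im z -> g z = \sum_(j < d) a j * f j z ->
  normc (g z) ^+ 2 * complex.Im z ^+ (2 * k) <=
  (\sum_(j < d) normc (a j) ^+ 2) * S_Gamma k f z.
Proof.
move=> y0 ->; rewrite /S_Gamma -mulr_suml mulrA ler_wpM2r ?exprn_ge0 ?(ltW y0)//.
apply: le_trans (cauchy_schwarz_sum _ _).
rewrite lerXn2r ?nnegrE ?normc_ge0//.
  by apply: sumr_ge0 => j _; rewrite mulr_ge0 ?normc_ge0.
apply: le_trans (normc_sum _ _ _) _.
by apply: ler_sum => j _; rewrite normcM.
Qed.

Local Notation E := (expR 1 : R).
Local Notation C1 := (remainder_const R).

(** Where y^k exp(-2 pi y) is maximal. *)
Definition peak_height k : R := k%:R / (2 * pi).

(** Here |2e(z)| = 2 exp(-k), and the remainder C y^(4-2k) is at most exp(-k)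
    because y^(2k-4) >= y^k >= 8^k exp(k) and 8^k >= k >= C. *)
Lemma poincare_lower k : (4 <= k)%N -> C1 <= k%:R -> 8 * E <= peak_height k ->
  E ^- k <= normc (poincare k (0 +i* peak_height k)).
Proof.
have E1 : 1 <= E by rewrite -[1 in leLHS]expR0 ler_expR.
move=> k4 kC; set y := peak_height k => yE.
have y1 : 1 <= y by lra.
have k2 : (2 <= k)%N by apply: leq_trans k4.
have lead : normc (poincare k (0 +i* y) - 2 * qexp (0 +i* y)) <= C1 * y ^- (2 * k - 4).
  by apply: poincare_leading; rewrite //= ?normr0 ?invr_ge0//; lra.
have pi0 := @pi_gt0 R.
have qE : normc (2 * qexp (0 +i* y)) = 2 * E ^- k.
  rewrite normcM normc_qexp /= ; congr (_ * _); first by have := normc_int R 2.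
  have -> : pi *+ 2 * y = k%:R * 1 by rewrite /y /peak_height mulr1 -mulr_natl; field; lra.
  by rewrite expRN expRM_natl.
have small : C1 * y ^- (2 * k - 4) <= E ^- k.
  have Ek : 0 < E ^+ k by rewrite exprn_gt0//; lra.
  have yk : 0 < y ^+ (2 * k - 4) by rewrite exprn_gt0//; lra.
  rewrite ler_pdivrMr// mulrC ler_pdivlMr//.
  apply: (@le_trans _ _ ((8 * E) ^+ k)).
    rewrite exprMn ler_wpM2r ?(ltW Ek)// (le_trans kC)//.
    rewrite -natrX ler_nat; apply: ltnW; exact: ltn_expl.
  apply: (@le_trans _ _ (y ^+ k)); first by rewrite lerXn2r ?nnegrE//; lra.
  by rewrite ler_weXn2l//; lia.
have := ler_normcB (poincare k (0 +i* y)) (poincare k (0 +i* y) - 2 * qexp (0 +i* y)).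
have -> : poincare k (0 +i* y) - (poincare k (0 +i* y) - 2 * qexp (0 +i* y)) =
  2 * qexp (0 +i* y) by ring.
rewrite qE; lra.
Qed.

(** The maximum of y^(2k) exp(-4 pi y). *)
Definition peak k : R := (peak_height k / E) ^+ (2 * k).

(** Stirling for (2k)!, together with (2k)! >= 2 k^2 (2k-2)!, pi <= 4 and
    sqrt(2k) <= 2 sqrt k. *)
Lemma gamma_factor_le k : (0 < k)%N ->
  8 * ((2 * k - 2)`!%:R / (4 * pi) ^+ (2 * k - 2).+1) * (k%:R * Num.sqrt k%:R)
  <= 128 * E * peak k.
Proof.
move=> k0; have pi0 := @pi_gt0 R.
have pi4 : pi <= 4 :> R by have := @pihalf_lt2 R; lra.
have E0 : 0 < E by exact: expR_gt0.
have e2k : ((2 * k - 2).+1.+1 = 2 * k)%N by clear -k0; lia.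
have K1 : 1 <= k%:R :> R by rewrite (ler_nat _ 1).
have K0 : 0 < k%:R :> R by lra.
have st : (2 * k)`!%:R * E ^+ (2 * k) <= E * Num.sqrt (2 * k)%:R * (2 * k)%:R ^+ (2 * k) :> R.
  by apply: fact_stirling_le; rewrite muln_gt0.
have fE : (2 * k)`!%:R = (2 * k%:R) * (2 * k%:R - 1) * (2 * k - 2)`!%:R :> R.
  have [n kE] : exists n, (2 * k = n.+2)%N by exists (2 * k - 2)%N; lia.
  rewrite -natrM kE subn2 /= !factS !natrM -[n.+2%:R]natr1 mulrA; congr (_ * _ * _).
  by rewrite addrK.
have s2 : Num.sqrt (2 * k)%:R <= 2 * Num.sqrt k%:R :> R.
  rewrite -ler_sqr ?nnegrE ?mulr_ge0 ?sqrtr_ge0// exprMn !sqr_sqrtr// natrM; lra.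
set s := Num.sqrt k%:R in s2 *.
have ss : s * s = k%:R by rewrite -expr2 sqr_sqrtr.
have s0 : 0 <= s by exact: sqrtr_ge0.
have pk : (4 * pi) ^+ (2 * k) * E ^+ (2 * k) * peak k = (2 * k)%:R ^+ (2 * k).
  rewrite /peak -!exprMn; congr (_ ^+ _); rewrite /peak_height natrM.
  move: (pi : R) pi0 => p p0; field.
  by rewrite (lt0r_neq0 E0) (lt0r_neq0 p0).
have Ek0 : 0 < E ^+ (2 * k) by rewrite exprn_gt0.
have q0 : 0 < (4 * pi) ^+ (2 * k - 2).+1 :> R by rewrite exprn_gt0// mulr_gt0.
have qE : (4 * pi) ^+ (2 * k) = (4 * pi) ^+ (2 * k - 2).+1 * (4 * pi) :> R.
  by rewrite -exprSr e2k.
have p0 : 0 <= peak k.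
  by rewrite exprn_ge0// divr_ge0 ?(ltW E0)// divr_ge0// mulr_ge0 ?(ltW pi0).
have f0 : 0 <= (2 * k - 2)`!%:R :> R by exact: ler0n.
rewrite -pk qE fE {pk qE fE} in st.
move: (E ^+ (2 * k)) ((4 * pi) ^+ (2 * k - 2).+1) (peak k) ((2 * k - 2)`!%:R)
  Ek0 q0 p0 f0 st => e q p f e0 q0 p0 f0 st.
move: E E0 (Num.sqrt (2 * k)%:R) s2 st => c c0 t ts st.
move: (k%:R) K1 K0 ss st => K K1 K0 ss st.
have h1 : 2 * K * (2 * K - 1) * f <= c * (2 * s) * (q * (4 * pi) * p).
  rewrite -(ler_pM2r e0); apply: (le_trans st).
  have -> : q * (4 * pi) * e * p = q * (4 * pi) * p * e by ring.
  rewrite mulrA ler_wpM2r ?(ltW e0)// ler_wpM2r ?mulr_ge0 ?(ltW q0) ?(ltW pi0)//.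
  by rewrite ler_wpM2l ?(ltW c0).
have h2 : 2 * K * K * f <= 2 * K * (2 * K - 1) * f.
  by rewrite ler_wpM2r// ler_wpM2l; lra.
have h3 : c * (2 * s) * (q * (4 * pi) * p) <= c * (2 * s) * (q * 16 * p).
  rewrite ler_wpM2l ?mulr_ge0 ?(ltW c0)// ler_wpM2r// ler_wpM2l ?(ltW q0)//; lra.
have h4 : 2 * K * K * f * s <= c * (2 * s) * (q * 16 * p) * s.
  by rewrite ler_wpM2r//; lra.
have h5 : 2 * K * (K * f * s) <= 2 * K * (16 * c * q * p).
  have -> : 2 * K * (16 * c * q * p) = c * (2 * s) * (q * 16 * p) * s.
    by rewrite -ss; ring.
  lra.
have h6 : K * f * s <= 16 * c * q * p.
  by rewrite ler_pM2l in h5; lra.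
have -> : 8 * (f / q) * (K * s) = 8 * (K * f * s) / q by field; rewrite gt_eqF.
rewrite ler_pdivrMr//; lra.
Qed.

(** The peak is at least 64^k, and 64^k = 2^k 2^k (2^k)^4 with 2^k >= k. *)
Lemma tail_factor_le k : 4 * C1 ^+ 2 <= k%:R -> 8 * E <= peak_height k ->
  4 * C1 ^+ 2 * 2 ^+ k * (k%:R * Num.sqrt k%:R) <= peak k.
Proof.
have E1 : 1 <= E by rewrite -[1 in leLHS]expR0 ler_expR.
move=> kC yE; have C0 := remainder_const_ge1 R.
have C2 : 1 <= C1 ^+ 2 by rewrite exprn_ege1.
move: (C1 ^+ 2) C2 kC {C0} => c C2 kC.
have K1 : 1 <= k%:R :> R by lra.
have k2 : k%:R <= 2 ^+ k :> R by rewrite -natrX ler_nat; apply: ltnW; exact: ltn_expl.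
have sk : Num.sqrt k%:R <= k%:R :> R.
  by rewrite -ler_sqr ?nnegrE ?sqrtr_ge0// sqr_sqrtr// expr2 ler_peMl//; lra.
have p64 : 64 ^+ k <= peak k.
  rewrite /peak exprM; apply: lerXn2r; rewrite ?nnegrE ?sqr_ge0//.
  have : 8 <= peak_height k / E by rewrite ler_pdivlMr; lra.
  by move=> h; rewrite expr2; nra.
apply: le_trans p64.
have -> : 64 = 2 * 2 * (2 * 2) * (2 * 2) :> R by ring.
rewrite !exprMn; move: (2 ^+ k) k2 => u ku.
have u0 : 1 <= u by lra.
have h1 : 4 * c * u <= u * u by rewrite ler_wpM2r//; lra.
have h2 : k%:R * Num.sqrt k%:R <= u * u.
  by apply: ler_pM; rewrite ?sqrtr_ge0//; lra.
have a0 : 0 <= 4 * c * u by apply: mulr_ge0; lra.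
have b0 : 0 <= k%:R * Num.sqrt k%:R :> R by apply: mulr_ge0 => //; exact: sqrtr_ge0.
apply: le_trans (ler_pM a0 b0 h1 h2) _.
have uu : 1 <= u * u by nra.
have u4 : 0 <= u * u * (u * u) by apply: mulr_ge0; lra.
by rewrite ler_peMr.
Qed.

End Final.

Theorem mainTheorem3 (R : realType) (eps : R) (heps : 0 < eps) :
  exists c : R, 0 < c /\ exists k0 : nat,
    forall k : nat, (0 < k)%N -> (k0 <= k)%N ->
    forall (d : nat) (f : 'I_d -> R[i] -> R[i]),
      orthonormal_cusp_basis k f ->
      ((c * k%:R `^ (3%:R / 2%:R - eps))%:E <=
        ereal_sup [set (S_Gamma k f z)%:E | z in @upper_half_plane R])%E.
Proof.
have E1 : 1 <= expR 1 :> R by rewrite -[1 in leLHS]expR0 ler_expR.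
have pi0 := @pi_gt0 R.
pose D : R := 128 * expR 1 + 1.
have D0 : 0 < D by rewrite /D; lra.
exists D^-1; split; first by rewrite invr_gt0.
have C1 := remainder_const_ge1 R.
(* The three summands make k/(2 pi) >= 8 exp 1, k >= 4 C^2 and k >= 4. *)
pose M : R := 16 * pi * expR 1 + 4 * remainder_const R ^+ 2 + 4.
exists (Num.truncn M).+1 => k k0 Mk d f [[cf _ span] on].
have kM : M < k%:R by apply: lt_le_trans (truncnS_gt M) _; rewrite ler_nat.
have pe0 : 0 < pi * expR 1 :> R by rewrite mulr_gt0//; lra.
have CC : remainder_const R <= remainder_const R ^+ 2 by rewrite expr2 ler_peMl//; lra.
have k4 : (4 <= k)%N by rewrite -(ler_nat R); rewrite /M in kM; lra.
have kC : remainder_const R <= k%:R by rewrite /M in kM; lra.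
have kCC : 4 * remainder_const R ^+ 2 <= k%:R by rewrite /M in kM; lra.
have ky : 8 * expR 1 <= peak_height R k.
  by rewrite /peak_height ler_pdivlMr ?mulr_gt0//; rewrite /M in kM; lra.
have [a aE] := span _ (poincare_cusp_form R (ltnW k4)).
pose z0 : R[i] := 0 +i* (peak_height R k).
have y0 : 0 < peak_height R k by rewrite divr_gt0 ?mulr_gt0 ?ltr0n.
have hol j : holomorphic (f j) by case: (cf j).
have norm_le := poincare_norm_le k4 hol on aE.
have ext := @S_Gamma_extremal R k d f a (@poincare R k) z0 y0 (aE z0 y0).
have low := poincare_lower k4 kC ky.
have gam := gamma_factor_le R k0.
have tail := tail_factor_le kCC ky.
set N := \sum_(j < d) _ in norm_le ext.
set S := S_Gamma k f z0 in ext.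
have K1 : 1 <= k%:R :> R by rewrite (ler_nat _ 1).
set T := k%:R * Num.sqrt k%:R in gam tail.
have T0 : 0 < T by rewrite mulr_gt0 ?sqrtr_gt0//; lra.
have NT : N * T <= D * peak R k.
  have : N * T <= (8 * ((2 * k - 2)`!%:R / (4 * pi) ^+ (2 * k - 2).+1) +
     4 * remainder_const R ^+ 2 * 2 ^+ k) * T by rewrite ler_wpM2r ?(ltW T0).
  rewrite mulrDl /D; lra.
have pk0 : 0 < peak R k.
  by rewrite exprn_gt0// divr_gt0//; lra.
have lower : peak R k <= N * S.
  have low2 : expR 1 ^- (2 * k) <= normc (poincare k z0) ^+ 2 :> R.
    rewrite mulnC exprM -exprVn; apply: lerXn2r low; rewrite nnegrE.
      by rewrite invr_ge0 exprn_ge0//; lra.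
    exact: normc_ge0.
  apply: le_trans ext; rewrite /peak expr_div_n mulrC.
  by rewrite ler_wpM2r// exprn_ge0// ltW.
have S0 : 0 <= S.
  apply: sumr_ge0 => j _; rewrite mulr_ge0 ?sqr_ge0// exprn_ge0//; exact: ltW.
have TDS : T <= D * S.
  rewrite -(ler_pM2l pk0).
  have : peak R k * T <= N * S * T by rewrite ler_wpM2r ?(ltW T0).
  have : N * T * S <= D * peak R k * S by rewrite ler_wpM2r.
  lra.
have powT : k%:R `^ (3%:R / 2%:R - eps) <= T.
  apply: (@le_trans _ _ (k%:R `^ (1 + 2^-1))).
    by apply: ler_powR => //; lra.
  rewrite powRD; last by apply/implyP => _; apply: lt0r_neq0; lra.
  by rewrite powRr1 ?powR12_sqrt.
apply: (@le_trans _ _ S%:E); last by apply: ereal_sup_ubound; exists z0.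
by rewrite lee_fin ler_pdivrMl// (le_trans powT).
Qed.
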